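(* Let $s\in\mathbb{Z}_{\ge2}$, and let all graph patterns below have ambient multiplicity $a=1$ (so for a graph $H$, the pattern is $H^{(1)}$). Then: (i) for $\binom{s}{2}\le q<\Sigma_{K_{1,2}}(s)$, $\mathrm{ex}_\Sigma(s,q)=1$; (ii) for $\Sigma_{K_{1,2}}(s)\le q<\Sigma_{P_4}(s)$, $\mathrm{ex}_\Sigma(s,q)=1+1/7$; (iii) for $\Sigma_{P_4}(s)\le q<\Sigma_{K_{1,3}}(s)$, $\mathrm{ex}_\Sigma(s,q)=1+1/6$; (iv) for $\Sigma_{K_{1,3}}(s)\le q<\Sigma_{K_{1,4}}(s)$, $\mathrm{ex}_\Sigma(s,q)=1+1/5$.
   Context: A multigraph $G=(V,w)$ is a finite vertex set with $w\colon\binom V2\to\mathbb{Z}_{\ge0}$; $e(X)=\sum_{uv\in\binom X2}w(uv)$, $e(G)=e(V)$. $G$ is an $(s,q)$-graph if $e(X)\le q$ for every $s$-set $X$. $\mathrm{ex}_\Sigma(n,s,q)$ is the maximum of $e(G)$ over $(s,q)$-graphs on $[n]$, and $\mathrm{ex}_\Sigma(s,q)=\lim_{n\to\infty}\mathrm{ex}_\Sigma(n,s,q)/\binom n2$ (the limit exists). A pattern $P$ on a finite set $V(P)$ assigns non-negative integer multiplicities to vertices (loops) and pairs; a blow-up of $P$ on $[s]$ is a multigraph on $[s]$ with a map $f\colon[s]\to V(P)$ (not necessarily surjective) such that $w(vv')=P(\{f(v),f(v')\})$ for distinct $v,v'$ (a loop multiplicity if $f(v)=f(v')$); $\Sigma_P(s)$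 is the maximum of $e(G)$ over blow-ups $G$ of $P$ on $[s]$. For a graph $H$ and $a\ge1$, $H^{(a)}$ is the pattern on $V(H)$ with loops of multiplicity $a-1$, non-adjacent pairs of multiplicity $a$, edges of multiplicity $a+1$. $K_{1,\ell}$ is the star with $\ell$ leaves and $P_4$ the path on $4$ vertices. *)

(* Defs.v *)
From HB Require Import structures.
From mathcomp Require Import all_boot all_order all_algebra.
From mathcomp Require Import all_classical all_reals all_analysis.
Set Implicit Arguments.
Unset Strict Implicit.
Unset Printing Implicit Defensive.
Import Order.TTheory GRing.Theory Num.Theory.
Import numFieldNormedType.Exports.

Local Open Scope classical_set_scope.

(* The maximum of a set of naturals; 0 if there is none. *)
Definition max_of (S : set nat) : nat :=
  xget 0 [set m | S m /\ forall k, S k -> k <= m].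

(* Only the values of w on two-element sets are ever used. *)
Definition multigraph (V : finType) := {set V} -> nat.

Definition esum_in (V : finType) (w : multigraph V) (X : {set V}) : nat :=
  \sum_(A : {set V} | (#|A| == 2) && (A \subset X)) w A.

Definition esize (V : finType) (w : multigraph V) : nat := esum_in w [set: V]%SET.

Definition sq_graph (V : finType) (s q : nat) (w : multigraph V) : Prop :=
  forall X : {set V}, #|X| = s -> esum_in w X <= q.

(* For n < s there is no maximum (every multigraph is an (s,q)-graph) and the
   value is 0; for 2 <= s <= n it is a genuine maximum, see exSigmaP. *)
Definition exSigma (n s q : nat) : nat :=
  max_of [set esize w | w in [set w : multigraph 'I_n | sq_graph s q w]].

(* Its limit is the density ex_Sigma(s,q). *)
Definition exSigma_ratio (R : realType) (s q n : nat) : R :=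
  ((exSigma n s q)%:R / 'C(n, 2)%:R)%R.

(* P [set x] is the multiplicity of the loop at x, P [set x; y] that of the
   pair xy; other values are never used. *)
Definition pattern (V : finType) := {set V} -> nat.

(* If f v = f v' then [set f v; f v'] is a singleton: a loop multiplicity. *)
Definition blowup_of (V : finType) (P : pattern V) (s : nat)
    (w : multigraph 'I_s) : Prop :=
  exists f : 'I_s -> V,
    forall v v', v != v' -> w [set v; v']%SET = P [set f v; f v']%SET.

Definition Sigma (V : finType) (P : pattern V) (s : nat) : nat :=
  max_of [set esize w | w in [set w : multigraph 'I_s | blowup_of P w]].

(* A graph is given by its set E of edges, which are two-element sets. *)
Definition graph_pattern (V : finType) (E : {set {set V}}) (a : nat) :
    pattern V :=
  fun A => if #|A| == 1 then a.-1 else if A \in E then a.+1 else a.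

Definition star (l : nat) : {set {set 'I_l.+1}} :=
  [set [set ord0; lift ord0 i] | i : 'I_l]%SET.

(* lift ord0 i has value i.+1. *)
Definition path4 : {set {set 'I_4}} :=
  [set [set widen_ord (leqnSn 3) i; lift ord0 i] | i : 'I_3]%SET.

Lemma max_ofP (S : set nat) (m0 N : nat) :
  S m0 -> (forall k, S k -> k <= N) ->
  S (max_of S) /\ forall k, S k -> k <= max_of S.
Proof.
move=> Sm0 SN; rewrite /max_of.
have exS : exists m, `[< S m >] by exists m0; apply/asboolP.
have ubS m : `[< S m >] -> m <= N by move=> /asboolP /SN.
case: (ex_maxnP exS ubS) => m /asboolP Sm mmax.
apply: (@xgetPex _ 0 [set m | S m /\ forall k, S k -> k <= m]).
by exists m; split=> // k Sk; apply/mmax/asboolP.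
Qed.

Lemma exSigmaP (n s q : nat) : 2 <= s -> s <= n ->
  (exists2 w : multigraph 'I_n, sq_graph s q w & esize w = exSigma n s q) /\
  forall w : multigraph 'I_n, sq_graph s q w -> esize w <= exSigma n s q.
Proof.
move=> s2 sn.
pose S := [set esize w | w in [set w : multigraph 'I_n | sq_graph s q w]].
have S0 : S 0.
  exists (fun=> 0); last by rewrite /esize /esum_in big1.
  by move=> X _; rewrite /esum_in big1.
have Sub k : S k -> k <= \sum_(A : {set 'I_n} | #|A| == 2) q.
  move=> [w ws <-]; rewrite /esize /esum_in big_mkcondr /=.
  apply: leq_sum => A A2; rewrite finset.subsetT.
  have [X AX /eqP Xs] : exists2 X : {set 'I_n}, A \subset X & #|X| == s.
    clear -s2 sn A2; elim: s s2 sn => // t IH; rewrite leq_eqVlt => /predU1P[[tE] _|t2 tn].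
      by exists A; rewrite // -tE (eqP A2).
    have [X AX /eqP Xt] := IH t2 (ltnW tn).
    have /card_gt0P[x] : 0 < #|~: X| by rewrite cardsCs finset.setCK card_ord Xt subn_gt0.
    rewrite inE => xX; exists (x |: X)%SET; last by rewrite cardsU1 xX Xt.
    by apply: fintype.subset_trans AX _; exact: finset.subsetUr.
  apply: leq_trans (ws _ Xs).
  by rewrite /esum_in (bigD1 A) ?A2 ?AX //= leq_addr.
have [[w ws wE] mx] := max_ofP S0 Sub.
by split=> [|v vs]; [exists w | apply: mx; exists v].
Qed.

Lemma SigmaE (V : finType) (P : pattern V) (s : nat) (x0 : V) :
  Sigma P s = \max_(f : {ffun 'I_s -> V})
    esize (fun A : {set 'I_s} => P (f @: A)%SET).
Proof.
pose F (f : 'I_s -> V) := esize (fun A : {set 'I_s} => P (f @: A)%SET).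
pose S := [set esize w | w in [set w : multigraph 'I_s | blowup_of P w]].
have FE (f g : 'I_s -> V) : f =1 g -> F f = F g.
  by move=> fg; apply: eq_bigr => A _; rewrite (eq_imset _ fg).
have SF (f : 'I_s -> V) : S (F f).
  exists (fun A : {set 'I_s} => P (f @: A)%SET) => //.
  by exists f => v v' _; rewrite imsetU !imset_set1.
have FS k : S k -> exists f : {ffun 'I_s -> V}, k = F f.
  move=> [w [f fP] <-]; exists (finfun f).
  rewrite (FE _ f (ffunE f)); apply: eq_bigr => A /andP[/cards2P[v [v' [vv' ->]]] _].
  by rewrite fP // imsetU !imset_set1.
have ub k : S k -> k <= \max_(f : {ffun 'I_s -> V}) F f.
  by move=> /FS[f ->]; exact: (leq_bigmax f).
have [SM mx] := max_ofP (SF (fun=> x0)) ub.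
apply/eqP; rewrite eqn_leq ub //=.
by apply/bigmax_leqP => f _; apply: mx; exact: SF.
Qed.

(* Main.v *)
Require Import Defs.
From mathcomp Require Import all_boot all_order all_algebra.
From mathcomp Require Import all_classical all_reals all_analysis.
From mathcomp Require Import zify ring lra.
Set Implicit Arguments.
Unset Strict Implicit.
Unset Printing Implicit Defensive.
Import Order.TTheory GRing.Theory Num.Theory.
Import numFieldNormedType.Exports.

(* Lower bounds come from blow-ups of K_{1,2}, P_4 and K_{1,3} with part sizes
   in the proportions 3:2:2, 1:2:2:1 and 2:1:1:1.

   For the upper bounds, almost all m-subsets of a large (s,q)-graph induce a
   multigraph W all of whose blow-ups on s vertices (with loops 0) have at most
   q edges, since a frequent W occurs blown up.  It remains to bound the
   Lagrangian x^T W x of such a W on the simplex.  Moving x along a direction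
   of nonnegative curvature until a coordinate vanishes, one may assume that
   the support contains no pair of multiplicity 0 and no two edges of
   multiplicity 2 that are joined by pairs of multiplicity 1 only.  Explicit
   remappings of parts show that an edge of multiplicity 3, a triangle or a
   4-cycle of edges of multiplicity 2 would give at least Sigma_{K_{1,4}}(s)
   edges.  So the graph of the edges of multiplicity 2 is 2K_2-, C_3- and
   C_4-free, hence, up to isolated vertices, a 5-cycle or a double star; the
   hypothesis on q bounds the degrees of the double star (and excludes the
   5-cycle except in (iv)), and sums of squares give the densities. *)

(** * Counting in finite sets *)

Lemma sum_pairs (V : finType) (F : {set V} -> nat) (X : {set V}) :
  \sum_(u in X) \sum_(v in X | v != u) F [set u; v]%SET = 2 * esum_in F X.
Proof.
rewrite /esum_in pair_big_dep /=.
rewrite (partition_big (fun p : V * V => [set p.1; p.2]%SET)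
  (fun A : {set V} => (#|A| == 2) && (A \subset X))) /=; last first.
  move=> [u v] /= /and3P[uX vX vu]; rewrite cards2 [u == v]eq_sym vu eqxx /=.
  by apply/fintype.subsetP => z; rewrite !inE => /orP[] /eqP ->.
rewrite big_distrr /=; apply: eq_bigr => A /andP[/cards2P[a [b [ab AE]]] AX].
rewrite (eq_bigr (fun=> F A)); last by move=> [u v] /= /andP[_ /eqP ->].
have aX : a \in X by apply: (fintype.subsetP AX); rewrite AE !inE eqxx.
have bX : b \in X by apply: (fintype.subsetP AX); rewrite AE !inE eqxx orbT.
rewrite (bigD1 (a, b)) /=; last by rewrite aX bX [b == a]eq_sym ab AE eqxx.
rewrite (bigD1 (b, a)) /=; last first.
  by rewrite aX bX ab AE finset.setUC eqxx /= xpair_eqE negb_and [b == a]eq_sym ab.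
rewrite big1 ?addn0 ?mul2n ?addnn // => [[u v]] /=.
rewrite AE => /andP[/andP[/andP[/and3P[_ _ vu] /eqP E]]] h1 h2.
have : u \in [set a; b]%SET by rewrite -E !inE eqxx.
have : v \in [set a; b]%SET by rewrite -E !inE eqxx orbT.
rewrite !inE => /orP[] /eqP ? /orP[] /eqP ?; subst; move: h1 h2 vu; by rewrite !eqxx.
Qed.

Lemma finset_exists_card (T : finType) (A : {set T}) k : k <= #|A| ->
  exists2 U : {set T}, U \subset A & #|U| = k.
Proof.
elim: k => [|k IH] kA; first by exists finset.set0; rewrite ?finset.sub0set ?cards0.
have [U UA Uk] := IH (ltnW kA).
have /card_gt0P[z] : 0 < #|A :\: U|%SET.
  by rewrite cardsD (finset.setIidPr UA) Uk subn_gt0.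
rewrite inE => /andP[zU zA]; exists (z |: U)%SET; last by rewrite cardsU1 zU Uk.
by rewrite finset.subUset finset.sub1set zA.
Qed.

Lemma large_fibre (T D : finType) (Y : {set T}) (B : {set D}) (g : T -> D) :
  {in Y, forall y, g y \in B} -> 0 < #|B| ->
  exists2 S, S \in B & #|Y| <= #|B| * #|[set y in Y | g y == S]%SET|.
Proof.
move=> gB /card_gt0P[S0 S0B].
pose h S := #|[set y in Y | g y == S]%SET|.
have [S SB Smax] := @arg_maxnP D S0 (fun S => S \in B) h S0B.
exists S => //; rewrite -sum_nat_const.
rewrite -sum1_card (partition_big g (fun S => S \in B)) //=.
apply: leq_sum => S' S'B; rewrite sum1dep_card.
by apply: leq_trans (Smax _ S'B); rewrite /h cardsE.
Qed.

(** Greedy choice: fewer than [k] elements are taken whenever the next one is chosen. *)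
Lemma distinct_representatives (V : finType) (k : nat) (A : 'I_k -> {set V}) :
  (forall i, k <= #|A i|) ->
  exists2 x : 'I_k -> V, injective x & forall i, x i \in A i.
Proof.
move=> kA.
suff H j : j <= k -> exists2 x : seq V, uniq x /\ size x = j &
    forall i : 'I_k, forall (ij : i < j) v0, nth v0 x i \in A i.
  have [x [ux sx] xA] := H k (leqnn k).
  case: k A kA x ux sx xA {H} => [|k] A kA x ux sx xA.
    by exists (fun i : 'I_0 => match i with Ordinal _ h => False_rect _ (notF h) end); case.
  case: x ux sx xA => // v0 x ux sx xA.
  exists (fun i : 'I_k.+1 => nth v0 (v0 :: x) i) => [i j /eqP|i]; last by apply: xA.
  by rewrite nth_uniq ?sx // => /eqP/val_inj.
elim: j => [|j IH] jk; first by exists [::].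
have [x [ux sx] xA] := IH (ltnW jk).
have /card_gt0P[z] : 0 < #|A (Ordinal jk) :\: [set:: x]|%SET.
  have h : #|A (Ordinal jk) :&: [set:: x]|%SET <= j.
    apply: (leq_trans (subset_leq_card (finset.subsetIr _ _))).
    by rewrite cardsE (leq_trans (card_size _)) // sx.
  by rewrite cardsD subn_gt0 (leq_ltn_trans h) // (leq_trans jk).
rewrite !inE => /andP[zx zA]; exists (rcons x z).
  by rewrite rcons_uniq ux zx size_rcons sx.
move=> i; rewrite ltnS leq_eqVlt => /orP[/eqP ij|ij] v0; rewrite nth_rcons sx.
  by rewrite ij ltnn eqxx (_ : i = Ordinal jk) //; apply: val_inj.
by rewrite ij; apply: xA.
Qed.

(** * Boxes in dense sets of tuples *)

Lemma sum_card_fibre (S T : finType) (B : {set S}) (r : S -> T -> bool) :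
  \sum_(u in B) #|[set y | r u y]%SET| = \sum_y #|[set u in B | r u y]%SET|.
Proof.
under eq_bigr do rewrite cardsE -sum1_card.
under [RHS]eq_bigr do rewrite cardsE -sum1_card.
rewrite (exchange_big_dep predT) //=; by apply: eq_bigr.
Qed.

Lemma leq_sum_split (T : finType) (A : {set T}) (F : T -> nat) (a b : nat) :
  (forall x, x \in A -> F x <= a) -> (forall x, x \notin A -> F x <= b) ->
  \sum_x F x <= #|A| * a + #|T| * b.
Proof.
move=> Fa Fb; rewrite (bigID (mem A)) /= leq_add //.
  by rewrite -sum_nat_const leq_sum.
apply: (@leq_trans (\sum_(x | x \notin A) b)); first exact: leq_sum.
by rewrite sum_nat_const leq_mul2r max_card orbT.
Qed.

(** Erdos's theorem on complete m-partite subhypergraphs, by induction on [m]. Many first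
    coordinates have degree at least n^m/(2c); a bounded set [U] of them is fixed, and by double
    counting a positive proportion of the tails [y] see at least [t] elements of [U]. By pigeonhole
    one subset [S] of [U] is exactly what a positive proportion of the tails see, and the induction
    hypothesis applies to these tails. *)
Lemma box_of_dense (t m c : nat) : exists N, forall (V : finType)
    (E : {set m.-tuple V}), N <= #|V| -> #|V| ^ m <= c * #|E| ->
  exists2 T : 'I_m -> {set V}, forall i, t <= #|T i| &
    forall y : m.-tuple V, (forall i, tnth y i \in T i) -> y \in E.
Proof.
wlog t0 : t / 0 < t.
  move=> H; have [N NP] := H t.+1 isT; exists N => V E h1 h2.
  by have [T T1 T2] := NP _ _ h1 h2; exists T => // i; exact: ltnW.
elim: m c => [|m IH] c.
  exists 0 => V E _; rewrite expn0 muln_gt0 => /andP[_ /card_gt0P[y yE]].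
  by exists (fun=> finset.set0) => [[]|z] // _; rewrite tuple0 -(tuple0 y).
(* With [M] vertices of degree at least n^m/(2c) in [U], a tail sees 2t of them on average, so half
   of the count survives when the tails seeing fewer than [t] are discarded. *)
pose M := 4 * c * t; have [N' N'P] := IH (4 * c * 2 ^ M).
exists (maxn 1 (maxn N' (2 * c * M))) => V E; rewrite !geq_max => /and3P[n0 N'n Mn] En.
pose n := #|V|.
have nm0 : 0 < n ^ m by rewrite expn_gt0 n0.
pose r u (y : m.-tuple V) := [tuple of u :: y] \in E.
pose deg u := #|[set y | r u y]%SET|.
have sumdeg : \sum_u deg u = #|E|.
  have -> : \sum_u deg u = \sum_(u in [set: V]%SET) deg u.
    by apply: eq_bigl => u; rewrite inE.
  rewrite sum_card_fibre -[RHS]sum1_card.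
  under eq_bigr do rewrite -sum1_card.
  rewrite pair_big_dep /=.
  rewrite (reindex (fun z : m.+1.-tuple V => ([tuple of behead z], thead z))) /=.
    by apply: eq_bigl => z; rewrite !inE /r -tuple_eta.
  exists (fun p : m.-tuple V * V => [tuple of p.2 :: p.1]) => [z _|[y u] _] /=.
    by rewrite [RHS]tuple_eta.
  by congr (_, _); apply: val_inj.
have degle u : deg u <= n ^ m by rewrite -card_tuple max_card.
pose Hi := [set u | n ^ m <= 2 * c * deg u]%SET.
have HiM : M <= #|Hi|.
  have h : \sum_u 2 * c * deg u <= #|Hi| * (2 * c * n ^ m) + n * n ^ m.
    apply: leq_sum_split => u; first by rewrite leq_mul2l degle orbT.
    by rewrite inE -ltnNge => /ltnW.
  rewrite -big_distrr /= sumdeg in h.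
  move: En Mn; rewrite -/n expnS => En Mn.
  have c0 : 0 < c by case: (c) En => [|//]; rewrite mul0n leqn0 muln_eq0; lia.
  have : n * n ^ m <= #|Hi| * (2 * c) * n ^ m by lia.
  rewrite leq_mul2r; nia.
have [U UHi UM] := finset_exists_card HiM.
pose g (y : m.-tuple V) := [set u in U | r u y]%SET.
pose Y := [set y | t <= #|g y|]%SET.
have Ysize : n ^ m <= 4 * c * #|Y|.
  have h : \sum_y #|g y| <= #|Y| * M + n ^ m * t.
    rewrite -[n ^ m]/(#|V| ^ m) -card_tuple; apply: leq_sum_split => y yY.
      rewrite -UM; apply: subset_leq_card.
      by apply/fintype.subsetP => u; rewrite inE => /andP[].
    by move: yY; rewrite inE -ltnNge => /ltnW.
  rewrite -sum_card_fibre in h.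
  have : #|U| * n ^ m <= 2 * c * \sum_(u in U) deg u.
    rewrite -sum_nat_const big_distrr /=; apply: leq_sum => u uU.
    by have := fintype.subsetP UHi u uU; rewrite inE.
  rewrite UM /M => h2.
  have {h2} : 4 * c * t * n ^ m <= 2 * c * (#|Y| * M + n ^ m * t).
    by apply: leq_trans h2 _; rewrite leq_mul2l h orbT.
  have c0 : 0 < c by case: (c) En => [|//]; rewrite mul0n leqn0 expn_eq0; lia.
  have -> : 2 * c * (#|Y| * M + n ^ m * t) = (2 * c * t) * (4 * c * #|Y| + n ^ m).
    by rewrite /M; lia.
  have -> : 4 * c * t * n ^ m = (2 * c * t) * (n ^ m + n ^ m) by lia.
  rewrite leq_pmul2l; lia.
have [||S SU SY] := @large_fibre _ _ Y (powerset U) g.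
- move=> y _; rewrite powersetE; apply/fintype.subsetP => u.
  by rewrite inE => /andP[].
- by rewrite card_powerset expn_gt0.
rewrite card_powerset UM in SY.
set E' := finset _ in SY.
have E'n : n ^ m <= 4 * c * 2 ^ M * #|E'|.
  by apply: leq_trans Ysize _; rewrite -[leqRHS]mulnA leq_mul2l SY orbT.
have /card_gt0P[y0] : 0 < #|E'|.
  by move: (leq_trans nm0 E'n); rewrite muln_gt0 => /andP[].
rewrite !inE => /andP[ty0 /eqP y0S].
have [T' T't T'E] := N'P V E' N'n E'n.
exists (fun i => if unlift ord0 i is Some j then T' j else S) => [i|y yT].
  by case: unliftP => [j|] _; rewrite ?T't // -y0S.
case/tupleP: y yT => u y yT.
have : y \in E'.
  by apply: T'E => i; have := yT (lift ord0 i); rewrite liftK tnthS.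
rewrite inE => /andP[_ /eqP gS].
by have := yT ord0; rewrite unlift_none -gS inE => /andP[].
Qed.

(** * Upper bound by blow-up-bounded matrices *)

(** The zero diagonal lets sums run over all ordered pairs, and it matches the loops of multiplicity
    0. *)
Definition adj (V : finType) (w : multigraph V) (u v : V) : nat :=
  if u == v then 0 else w [set u; v]%SET.

Lemma adjxx (V : finType) (w : multigraph V) u : adj w u u = 0.
Proof. by rewrite /adj eqxx. Qed.

Lemma adjC (V : finType) (w : multigraph V) u v : adj w u v = adj w v u.
Proof. by rewrite /adj eq_sym finset.setUC. Qed.

Lemma sum_adj (V : finType) (w : multigraph V) (X : {set V}) :
  \sum_(u in X) \sum_(v in X) adj w u v = 2 * esum_in w X.
Proof.
rewrite -sum_pairs; apply: eq_bigr => u uX.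
rewrite [RHS]big_mkcondr /=; apply: eq_bigr => v _.
by rewrite /adj eq_sym; case: eqP.
Qed.

Lemma sum_adjT (V : finType) (w : multigraph V) :
  \sum_u \sum_v adj w u v = 2 * esize w.
Proof.
rewrite /esize -sum_adj; apply: eq_big => [u|u _]; first by rewrite inE.
by apply: eq_bigl => v; rewrite inE.
Qed.

Lemma sum_adj_inj (V : finType) (w : multigraph V) (s : nat) (x : 'I_s -> V) :
  injective x ->
  \sum_i \sum_j adj w (x i) (x j) = 2 * esum_in w (x @: 'I_s)%SET.
Proof.
move=> xi; rewrite -sum_adj big_imset /=; last by move=> ? ? _ _ /xi.
by apply: eq_bigr => i _; rewrite big_imset //= => ? ? _ _ /xi.
Qed.

(** Any pair extends to an [s]-set. The bound makes the number of types of [m]-tuples independent of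
    [n], and [inord] lossless in [tuple_type]. *)
Lemma adj_le (n s q : nat) (w : multigraph 'I_n) u v : 2 <= s -> s <= n ->
  sq_graph s q w -> adj w u v <= q.
Proof.
move=> s2 sn ws; rewrite /adj; case: eqVneq => // uv.
have A2 : #|[set u; v]%SET| = 2 by rewrite cards2 uv.
have [|B BA Bs] := @finset_exists_card _ (~: [set u; v])%SET (s - 2).
  by rewrite cardsCs finset.setCK A2 card_ord; lia.
have Xs : #|[set u; v] :|: B|%SET = s.
  rewrite cardsU A2 Bs (_ : _ :&: B = finset.set0)%SET ?cards0; first lia.
  by apply/eqP; rewrite finset.setI_eq0 disjoint_sym finset.disjoints_subset.
apply: leq_trans (ws _ Xs).
by rewrite /esum_in (bigD1 [set u; v]%SET) ?leq_addr //= A2 eqxx finset.subsetUl.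
Qed.

(* The sums run over ordered pairs, hence the factor 2. *)
Definition blowup_bounded (s q m : nat) (W : 'I_m -> 'I_m -> nat) : Prop :=
  [/\ forall i, W i i = 0, forall i j, W i j = W j i &
      forall f : 'I_s -> 'I_m, \sum_i \sum_j W (f i) (f j) <= 2 * q].

Definition tuple_type (n q m : nat) (w : multigraph 'I_n) (y : m.-tuple 'I_n) :
    {ffun 'I_m * 'I_m -> 'I_q.+1} :=
  [ffun p => inord (adj w (tnth y p.1) (tnth y p.2))].

(** A frequent type occurs on a whole box of sets [T k] of size at least [s]. These sets may
    overlap, so a map [f] is realised by distinct representatives of the sets [T (f i)]; they form
    an [s]-set, which has at most [q] edges. *)
Lemma frequent_type_bounded (s q m c : nat) : 2 <= s -> exists N, forall n
    (w : multigraph 'I_n) (ty : {ffun 'I_m * 'I_m -> 'I_q.+1}),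
  N <= n -> sq_graph s q w ->
  n ^ m <= c * #|[set y | tuple_type q w y == ty]%SET| ->
  blowup_bounded s q (fun i j => ty (i, j) : nat).
Proof.
move=> s2; have [N NP] := box_of_dense s m c.
exists (maxn N s) => n w ty; rewrite geq_max => /andP[Nn sn] ws big.
have [||T Ts TE] := NP _ [set y | tuple_type q w y == ty]%SET.
- by rewrite card_ord.
- by rewrite card_ord.
have tyE y i j : y \in [set y | tuple_type q w y == ty]%SET ->
    ty (i, j) = adj w (tnth y i) (tnth y j) :> nat.
  rewrite inE => /eqP <-; rewrite ffunE inordK // ltnS; exact: (adj_le _ _ s2).
have pick0 k : {v | v \in T k}.
  have /card_gt0P/cid : 0 < #|T k| by apply: leq_trans (Ts k); lia.
  by [].
have [y0 y0E] : {y0 | y0 \in [set y | tuple_type q w y == ty]%SET}.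
  exists [tuple of mktuple (fun k => sval (pick0 k))].
  by apply: TE => i; rewrite tnth_mktuple; case: (pick0 i).
have ty0 i : ty (i, i) = 0 :> nat by rewrite (tyE _ _ _ y0E) adjxx.
split=> // [i j|f]; first by rewrite !(tyE _ _ _ y0E) adjC.
have [x xi xT] := @distinct_representatives _ s (fun i => T (f i)) (fun i => Ts _).
rewrite (leq_trans _ (leq_mul (leqnn 2) (ws (x @: 'I_s)%SET _))) //; last first.
  by rewrite card_imset // card_ord.
rewrite -sum_adj_inj //; apply: leq_sum => i _; apply: leq_sum => j _.
have [->|fij] := eqVneq (f i) (f j); first by rewrite ty0.
(* A tuple of the box through both [x i] and [x j] shows that their multiplicity is the one
   prescribed by the type. *)
pose y := [tuple of mktuple (fun k => if k == f i then x i
  else if k == f j then x j else sval (pick0 k))].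
rewrite (tyE y); first by rewrite !tnth_mktuple eqxx eq_sym (negPf fij) eqxx.
apply: TE => k; rewrite tnth_mktuple.
by case: eqP => [->|_] //; case: eqP => [->|_] //; case: (pick0 k).
Qed.

(** Two distinct coordinates of a random tuple are uniformly distributed over ordered pairs. The
    involution [sw] exchanges these coordinates with a free pair. *)
Lemma sum_tuple_coords (V : finType) (m : nat) (i j : 'I_m) (F : V -> V -> nat) :
  i != j ->
  #|V| ^ 2 * \sum_(y : m.-tuple V) F (tnth y i) (tnth y j) =
  #|V| ^ m * \sum_u \sum_v F u v.
Proof.
move=> ij; have ji : (j == i) = false by rewrite eq_sym (negPf ij).
have -> : #|V| ^ 2 * \sum_(y : m.-tuple V) F (tnth y i) (tnth y j) =
    \sum_(z : m.-tuple V * (V * V)) F (tnth z.1 i) (tnth z.1 j).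
  rewrite -(pair_big predT predT (fun (y : m.-tuple V) (p : V * V) =>
    F (tnth y i) (tnth y j))) /= big_distrr /=; apply: eq_bigr => y _.
  by rewrite sum_nat_const card_prod mulnn.
have -> : #|V| ^ m * \sum_u \sum_v F u v =
    \sum_(z : m.-tuple V * (V * V)) F z.2.1 z.2.2.
  rewrite -(pair_big predT predT (fun (y : m.-tuple V) (p : V * V) =>
    F p.1 p.2)) /= sum_nat_const card_tuple; congr (_ * _).
  by rewrite pair_big.
pose sw (z : m.-tuple V * (V * V)) : m.-tuple V * (V * V) :=
  ([tuple of mktuple (fun k => if k == i then z.2.1 else if k == j then z.2.2
     else tnth z.1 k)], (tnth z.1 i, tnth z.1 j)).
have swK : involutive sw.
  move=> [y [u v]]; rewrite /sw /= !tnth_mktuple /= !eqxx ji.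
  congr (_, _); apply: eq_from_tnth => k; rewrite !tnth_mktuple.
  by case: eqP => [->|_] //; case: eqP => [->|_].
rewrite (reindex_inj (inv_inj swK)) /=; apply: eq_bigr => z _.
by rewrite !tnth_mktuple !eqxx ji.
Qed.

Section UpperBound.
Local Open Scope ring_scope.

(** The weight of the induced matrix is averaged over all [m]-tuples, repetitions included. Frequent
    types obey the hypothesis on [W]; the rare ones account for the error 1/L. *)
Lemma sq_graph_esize_le (R : realType) (s q : nat) (lam : R) (m L : nat) :
  (2 <= s)%N -> (0 < L)%N -> 0 <= lam ->
  (forall W : 'I_m -> 'I_m -> nat, blowup_bounded s q W ->
     (\sum_i \sum_j W i j)%:R <= lam * m%:R ^+ 2) ->
  exists N, forall n (w : multigraph 'I_n), (N <= n)%N -> sq_graph s q w ->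
    (m * m.-1 * (2 * esize w))%:R <= n%:R ^+ 2 * m%:R ^+ 2 * (lam + L%:R^-1).
Proof.
move=> s2 L0 lam0 H.
pose D := {ffun 'I_m * 'I_m -> 'I_q.+1}.
(* There are at most [#|D|] types of frequency below 1/c, each of weight at most m^2 q, so together
   they contribute at most m^2/L to the average. *)
pose c := (#|D| * (q.+1 * L))%N.
have [N NP] := @frequent_type_bounded s q m c s2.
exists (maxn N s) => n w; rewrite geq_max => /andP[Nn sn] ws.
have n0 : (0 < n)%N by lia.
have wt (ty : D) : (\sum_i \sum_j ty (i, j) <= m ^ 2 * q)%N.
  apply: (@leq_trans (\sum_(i < m) \sum_(j < m) q)).
    by apply: leq_sum => i _; apply: leq_sum => j _; rewrite -ltnS.
  by rewrite !sum_nat_const card_ord; lia.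
pose fib (ty : D) := #|[set y | tuple_type q w y == ty]%SET|.
have cntE : (n ^ 2 * \sum_ty fib ty * \sum_i \sum_j ty (i, j) =
    n ^ m * (m * m.-1 * (2 * esize w)))%N.
  transitivity (n ^ 2 * \sum_(y : m.-tuple 'I_n) \sum_i \sum_j
      adj w (tnth y i) (tnth y j))%N.
    congr (_ * _)%N.
    rewrite [RHS](partition_big (tuple_type q w) predT) //=.
    apply: eq_bigr => ty _; rewrite /fib -sum_nat_const.
    apply: eq_big => y; rewrite inE // => /eqP <-; apply: eq_bigr => i _.
    apply: eq_bigr => j _; by rewrite ffunE inordK // ltnS; apply: (adj_le _ _ s2).
  rewrite exchange_big /= big_distrr /=.
  transitivity (\sum_(i < m) n ^ m * (m.-1 * (2 * esize w)))%N; last first.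
    by rewrite sum_nat_const card_ord; lia.
  apply: eq_bigr => i _; rewrite exchange_big /= big_distrr /=.
  rewrite (bigD1 i) //= big1 ?muln0 ?add0n; last by move=> y _; rewrite adjxx.
  rewrite (eq_bigr (fun=> n ^ m * (2 * esize w))%N) => [|j ji].
    rewrite sum_nat_const (eq_card (_ : _ =i predC1 i)) // cardC1 card_ord.
    by lia.
  have := @sum_tuple_coords _ m i j (adj w); rewrite card_ord sum_adjT.
  by apply; rewrite eq_sym.
have R0 k : (0 : R) <= k%:R by rewrite ler0n.
have fibT : (\sum_ty fib ty = n ^ m)%N.
  rewrite -[X in (X ^ _)%N](card_ord n) -card_tuple -sum1_card.
  rewrite (partition_big (tuple_type q w) predT) //=.
  by apply: eq_bigr => ty _; rewrite /fib -sum1_card; apply: eq_bigl => y; rewrite inE.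
have key : (\sum_ty fib ty * \sum_i \sum_j ty (i, j))%:R <=
    (n ^ m)%:R * (m%:R ^+ 2 * (lam + L%:R^-1)) :> R.
  rewrite natr_sum.
  have L0' : (0 : R) < L%:R by rewrite ltr0n.
  apply: (@le_trans _ _ (\sum_(ty : D) ((fib ty)%:R * (lam * m%:R ^+ 2) +
      (n ^ m)%:R * (#|D|%:R^-1 * (m%:R ^+ 2 * L%:R^-1))))).
    apply: ler_sum => ty _; rewrite natrM.
    have D0 : (0 : R) < #|D|%:R by rewrite ltr0n; apply/card_gt0P; exists ty.
    have [big|small] := leqP (n ^ m) (c * fib ty).
      rewrite -[leLHS]addr0; apply: lerD; last by rewrite !mulr_ge0 ?invr_ge0 ?exprn_ge0.
      by rewrite ler_wpM2l //; apply: H; apply: (NP n w) => //.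
    rewrite -[leLHS]add0r; apply: lerD; first by rewrite !mulr_ge0 // exprn_ge0.
    apply: (@le_trans _ _ ((fib ty)%:R * (m ^ 2 * q)%:R)).
      by rewrite ler_wpM2l // ler_nat.
    have -> : (n ^ m)%:R * (#|D|%:R^-1 * (m%:R ^+ 2 / L%:R)) =
        (n ^ m * m ^ 2)%:R / (#|D| * L)%:R :> R.
      by rewrite !natrM natrX; field; rewrite !gt_eqF.
    rewrite ler_pdivlMr; last by rewrite natrM mulr_gt0.
    rewrite -!natrM ler_nat.
    have : (fib ty * (m ^ 2 * q) * (#|D| * L) <= c * fib ty * m ^ 2)%N.
      have -> : (fib ty * (m ^ 2 * q) * (#|D| * L) =
        fib ty * m ^ 2 * #|D| * L * q)%N by lia.
      have -> : (c * fib ty * m ^ 2 = fib ty * m ^ 2 * #|D| * L * q.+1)%N.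
        by rewrite /c; lia.
      by rewrite leq_mul2l leqnSn orbT.
    move/leq_trans; apply; rewrite leq_mul2r (ltnW small) orbT //.
  rewrite big_split /= -mulr_suml -natr_sum fibT sumr_const -mulr_natl.
  have D0 : (0 < #|D|)%N by apply/card_gt0P; exists [ffun=> ord0].
  have D0' : (0 : R) < #|D|%:R by rewrite ltr0n.
  rewrite le_eqVlt; apply/orP; left; apply/eqP; field.
  by rewrite !gt_eqF.
have {}key := ler_wpM2l (R0 (n ^ 2)%N) key.
rewrite -natrM cntE [leRHS](_ : _ =
  (n ^ m)%:R * (n%:R ^+ 2 * m%:R ^+ 2 * (lam + L%:R^-1))) in key; last first.
  by rewrite natrX; ring.
by rewrite natrM ler_pM2l ?ltr0n ?expn_gt0 ?n0 // in key.
Qed.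
End UpperBound.

(** * Convergence of the density *)

Section Convergence.
Local Open Scope classical_set_scope.
Local Open Scope ring_scope.

Lemma exSigma_ratio_cvg (R : realType) (s q d : nat) (lam : R) :
  (2 <= s)%N -> 0 <= lam ->
  (forall m (W : 'I_m -> 'I_m -> nat), blowup_bounded s q W ->
     (\sum_i \sum_j W i j)%:R <= lam * m%:R ^+ 2) ->
  (forall n, (s <= n)%N -> (d <= n)%N ->
     lam * (n%:R - d%:R) ^+ 2 <= (2 * exSigma n s q)%:R) ->
  exSigma_ratio R s q @ \oo --> lam.
Proof.
move=> s2 lam0 up low; apply/cvgrPdist_le => e e0.
(* With h = 1/L at most 1, (1 + h)^2 (lam + h) is at most lam + h (4 + 3 lam). *)
pose C : R := 4 + 3 * lam.
have C0 : 0 < C by rewrite /C; lra.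
pose L := (Num.truncn (C / e)).+1.
have L0 : (0 : R) < L%:R by rewrite ltr0n.
have Le : C / L%:R <= e.
  rewrite ler_pdivrMr // mulrC -ler_pdivrMr // ltW //.
  by rewrite /L; apply: truncnS_gt.
(* For m = L + 1 the factor m^2 / (m (m - 1)) is exactly 1 + 1/L. *)
have [N NP] := @sq_graph_esize_le R s q lam L.+1 L s2 isT lam0 (up _).
near=> n.
have sn : (s <= n)%N by near: n; exists s.
have Nn : (N <= n)%N by near: n; exists N.
have Ln : (L.+1 <= n)%N by near: n; exists L.+1.
(* This gives d <= n/L, so that replacing n^2 by (n - d)^2 costs at most 2 n^2/L. *)
have dn : (d * L <= n)%N by near: n; exists (d * L)%N.
have [[w ws wE] _] := exSigmaP q s2 sn.
have {}NP := NP n w Nn ws; rewrite wE in NP.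
have {}low := low n sn (leq_trans (leq_pmulr d (isT : 0 < L)%N) dn).
rewrite /exSigma_ratio.
set E : R := (exSigma n s q)%:R.
have binE : 'C(n, 2)%:R = n%:R * (n%:R - 1) / 2 :> R.
  have : (2 * 'C(n, 2) = n * n.-1)%N by rewrite -mul_bin_diag bin1.
  move/(congr1 (fun k => k%:R : R)); rewrite !natrM -subn1 natrB; last lia.
  by move=> h; rewrite -h; field.
rewrite binE.
pose x : R := n%:R; pose h : R := L%:R^-1.
have Lx : L%:R + 1 <= x by rewrite /x natr1 ler_nat.
have L1 : (1 : R) <= L%:R by rewrite ler1n.
have dx : d%:R * L%:R <= x by rewrite -natrM ler_nat.
have hL : h * L%:R = 1 by rewrite mulVf // gt_eqF.
have h0 : 0 < h by rewrite invr_gt0.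
have h1 : h <= 1 by rewrite -hL ler_peMr // ltW.
have hC : h * (4 + 3 * lam) <= e by rewrite mulrC.
have xx0 : 0 < x * (x - 1) by apply: mulr_gt0; lra.
have -> : E / (n%:R * (n%:R - 1) / 2) = 2 * E / (x * (x - 1)).
  have xn0 : x != 0 by apply: lt0r_neq0; lra.
  have xn1 : x - 1 != 0 by apply: lt0r_neq0; lra.
  by rewrite -/x; field; rewrite xn0 xn1.
have x1h : x <= (1 + h) * (x - 1) by nra.
have E2 : (2 * exSigma n s q)%:R = 2 * E by rewrite natrM.
rewrite E2 -/x in low.
have {}NP : 2 * E <= x ^+ 2 * (1 + h) * (lam + h).
  move: NP; rewrite natrM E2 -/h -/x /= natrM -natr1 => NP.
  rewrite -(@ler_pM2l _ ((L%:R + 1) * L%:R)); last by apply: mulr_gt0; lra.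
  apply: le_trans NP _; rewrite le_eqVlt; apply/orP; left; apply/eqP.
  have -> : h = L%:R^-1 by []. field; by rewrite gt_eqF.
rewrite ler_norml; apply/andP; split.
- rewrite lerBrDl -lerBrDr; rewrite opprK ler_pdivrMr //.
  apply: le_trans NP _.
  have t1 : (1 + h) * (1 + h) * (lam + h) <= lam + e.
    apply: (@le_trans _ _ (lam + h * (4 + 3 * lam))); last lra.
    nra.
  have t2 : x ^+ 2 * (1 + h) * (lam + h) <= x * ((1 + h) * (x - 1)) * (1 + h) * (lam + h).
    rewrite expr2; apply: ler_wpM2r; first lra. apply: ler_wpM2r; first lra.
    by apply: ler_wpM2l => //; lra.
  apply: le_trans t2 _.
  have -> : x * ((1 + h) * (x - 1)) * (1 + h) * (lam + h) =
    ((1 + h) * (1 + h) * (lam + h)) * (x * (x - 1)) by ring.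
  by rewrite ler_wpM2r // ltW.
- rewrite lerBlDl -lerBlDr ler_pdivlMr //.
  apply: le_trans low.
  have dh : d%:R <= h * x.
    have <- : h * (d%:R * L%:R) = d%:R by rewrite mulrCA hL mulr1.
    by rewrite ler_wpM2l // ltW.
  have d0 : (0 : R) <= d%:R by rewrite ler0n.
  have t1 : (lam - e) * (x * (x - 1)) <= (lam - 2 * lam * h) * (x * (x - 1)).
    have hl : 0 <= h * lam by rewrite mulr_ge0 // ltW.
    by apply: ler_wpM2r; [exact: ltW | nra].
  apply: le_trans t1 _.
  have -> : (lam - 2 * lam * h) * (x * (x - 1)) =
      lam * ((1 - 2 * h) * (x * (x - 1))) by ring.
  apply: ler_wpM2l => //.
  have [h12|h12] := leP 0 (1 - 2 * h); last first.
    by apply: (@le_trans _ _ 0); [rewrite pmulr_lle0 // ltW | exact: sqr_ge0].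
  have t3 : x * x - 2 * x * d%:R <= (x - d%:R) ^+ 2 by rewrite expr2; nra.
  apply: le_trans t3; apply: (@le_trans _ _ ((1 - 2 * h) * (x * x))); nra.
Unshelve. all: by end_near.
Qed.
End Convergence.

(** * Comparison of patterns *)

Lemma sum_fibres (s : nat) (T : finType) (f : 'I_s -> T) (h : T -> nat) :
  \sum_i h (f i) = \sum_a #|[set i | f i == a]%SET| * h a.
Proof.
rewrite (partition_big f predT) //=; apply: eq_bigr => a _.
rewrite -sum_nat_const; apply: eq_big => [i|i /eqP -> //].
by rewrite inE.
Qed.

Lemma exists_fibres (s k : nat) (x : 'I_k -> nat) : \sum_a x a = s ->
  exists f : 'I_s -> 'I_k, forall h, \sum_i h (f i) = \sum_a x a * h a.
Proof.
move=> xs; pose sq := flatten [seq nseq (x a) a | a <- enum 'I_k].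
have szsq : size sq == s.
  rewrite size_flatten /shape -map_comp sumnE big_map big_enum /= -xs.
  by apply/eqP; apply: eq_bigr => a _; rewrite size_nseq.
exists (tnth (Tuple szsq)) => h.
rewrite -(big_tuple _ _ (Tuple szsq) predT h) /= big_flatten big_map big_enum /=.
apply: eq_bigr => a _; elim: (x a) => [|j IH]; first by rewrite big_nil.
by rewrite /= big_cons IH mulSn.
Qed.

Lemma blowup_bounded_fibres (s q m k : nat) (W : 'I_m -> 'I_m -> nat)
    (h : 'I_k -> 'I_m) (x : 'I_k -> nat) :
  blowup_bounded s q W -> \sum_a x a = s ->
  \sum_a \sum_b x a * x b * W (h a) (h b) <= 2 * q.
Proof.
move=> [_ _ Wq] /exists_fibres[f fE].
apply: leq_trans (Wq (h \o f)) => /=.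
rewrite (fE (fun a => \sum_j W (h a) (h (f j)))); apply: leq_sum => a _.
rewrite (fE (fun b => W (h a) (h b))) big_distrr /=.
by apply: leq_sum => b _; rewrite mulnA.
Qed.

(** Five parts suffice for every pattern considered, the largest being C5 and [K_{1,4}]; smaller
    ones leave the surplus parts empty. *)
Lemma blowup_bounded5 (s q m : nat) (W : 'I_m -> 'I_m -> nat) a b c d e u v x y z :
  blowup_bounded s q W -> u + v + x + y + z = s ->
  u * v * W a b + u * x * W a c + u * y * W a d + u * z * W a e +
  v * x * W b c + v * y * W b d + v * z * W b e +
  x * y * W c d + x * z * W c e + y * z * W d e <= q.
Proof.
move=> Wb us; have [W0 WC _] := Wb.
have := @blowup_bounded_fibres s q m 5 W (tnth [tuple a; b; c; d; e])
  (tnth [tuple u; v; x; y; z]) Wb.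
rewrite !big_ord_recl !big_ord0 /= !(tnth_nth a) !(tnth_nth 0) /=.
rewrite !W0 (WC b a) (WC c a) (WC d a) (WC e a) (WC c b) (WC d b) (WC e b)
  (WC d c) (WC e c) (WC e d).
lia.
Qed.

Section Fits.
Variables s q : nat.

(* fits_H: every blow-up of H^(1) on s vertices, given by the sizes of its parts,
   has at most q edges; w3 stands for a single edge of multiplicity 3. *)
Definition fits_w3 := forall x y, x + y = s -> 3 * (x * y) <= q.
Definition fits_k3 := forall x y z, x + y + z = s ->
  2 * (x * y + y * z + z * x) <= q.
Definition fits_c4 := forall x y z t, x + y + z + t = s ->
  2 * (x * y + y * z + z * t + t * x) + x * z + y * t <= q.
Definition fits_c5 := forall x y z t u, x + y + z + t + u = s ->
  2 * (x * y + y * z + z * t + t * u + u * x) +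
  (x * z + x * t + y * t + y * u + z * u) <= q.
Definition fits_star2 := forall c x y, c + x + y = s ->
  2 * (c * x + c * y) + x * y <= q.
Definition fits_path4 := forall x y z t, x + y + z + t = s ->
  2 * (x * y + y * z + z * t) + (x * z + x * t + y * t) <= q.
Definition fits_star3 := forall c x y z, c + x + y + z = s ->
  2 * (c * x + c * y + c * z) + (x * y + x * z + y * z) <= q.
Definition fits_star4 := forall c x y z t, c + x + y + z + t = s ->
  2 * (c * x + c * y + c * z + c * t) +
  (x * y + x * z + x * t + y * z + y * t + z * t) <= q.

(** The count is the average of the three obtained by merging two of the parts [x], [y], [z] and
    putting multiplicity 3 between the merged part and the third one. *)
Lemma fits_k3_w3 : fits_w3 -> fits_k3.
Proof.
move=> H x y z xyz.
have := H x (y + z); have := H y (x + z); have := H z (x + y); lia.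
Qed.

(* Average over the three ways of splitting the leaves into two pairs. *)
Lemma fits_star4_k3 : fits_k3 -> fits_star4.
Proof.
move=> H c x y z t cs.
have := H c (x + y) (z + t); have := H c (x + z) (y + t).
have := H c (x + t) (y + z); lia.
Qed.

Lemma fits_star3_star4 : fits_star4 -> fits_star3.
Proof. by move=> H c x y z cs; have := H c x y z 0; lia. Qed.

(** Make the larger inner part the centre. If this is [y], the end [t] changes its heavy partner
    from [z] to [y], a gain of (y - z) t. *)
Lemma fits_path4_star3 : fits_star3 -> fits_path4.
Proof.
move=> H x y z t xs.
have [yz|zy] := leqP z y.
  have := H y x z t; have := leq_mul yz (leqnn t); lia.
have := H z x y t; have := leq_mul (leqnn x) (ltnW zy); lia.
Qed.

Lemma fits_star2_path4 : fits_path4 -> fits_star2.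
Proof. by move=> H c x y cs; have := H x c y 0; lia. Qed.

(* The balanced blow-up of C4 has floor(5s^2/8) edges. *)
Lemma fits_star4_c4 : fits_c4 -> fits_star4.
Proof.
move=> H c x y z t cs.
set N := (X in X <= q).
have N8 : 8 * N <= 5 * s ^ 2.
  have sq u v : 2 * (u * v) <= u ^ 2 + v ^ 2 := (nat_Cauchy u v).1.
  have := sq x y; have := sq x z; have := sq x t; have := sq y z; have := sq y t.
  have := sq z t; have := sq (5 * c) (3 * (x + y + z + t)); rewrite -cs /N; lia.
(* This says that [q] is at least the integer part of 5s^2/8. *)
suff : 5 * s ^ 2 <= 8 * q + 7 by lia.
pose k := s %/ 4.
have : s = 4 * k \/ s = 4 * k + 1 \/ s = 4 * k + 2 \/ s = 4 * k + 3 by rewrite /k; lia.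
case=> [|[|[|]]] sk.
- have := H k k k k; lia.
- have := H (k + 1) k k k; lia.
- have := H (k + 1) (k + 1) k k; lia.
- have := H (k + 1) (k + 1) (k + 1) k; lia.
Qed.

(* Splitting the centre as c = u + v over two non-adjacent vertices of C5
   changes the number of edges by (u - z) (v - y), which is nonnegative for a
   suitable splitting. *)
Lemma fits_star3_c5 : fits_c5 -> fits_star3.
Proof.
move=> H c x y z cs.
have [u [v [uv uvp]]] : exists u v, u + v = c /\ u * y + v * z <= u * v + y * z.
  have [cz|zc] := leqP c z; first by exists c, 0; split; [lia | nia].
  by exists z, (c - z); split; [lia | lia].
have := H u x v y z; subst c; lia.
Qed.

End Fits.

(** * Blow-ups of graph patterns *)

Section GraphPattern.
Variables (V : finType) (E : {set {set V}}).
Let P := graph_pattern E 1.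

Lemma graph_pattern1_loop a : P [set a; a]%SET = 0.
Proof. by rewrite /P /graph_pattern finset.setUid cards1. Qed.

Lemma adj_blowup (T : finType) (f : T -> V) u v :
  adj (fun A : {set T} => P (f @: A)%SET) u v = P [set f u; f v]%SET.
Proof.
rewrite /adj; case: eqP => [->|_]; first by rewrite graph_pattern1_loop.
by rewrite imsetU !imset_set1.
Qed.

Lemma blowup_le_Sigma (s : nat) (f : 'I_s -> V) (x0 : V) :
  \sum_i \sum_j P [set f i; f j]%SET <= 2 * Sigma P s.
Proof.
under eq_bigr do under eq_bigr do rewrite -adj_blowup.
rewrite sum_adjT leq_mul2l /= (SigmaE _ _ x0).
apply: leq_trans (leq_bigmax (finfun f)).
rewrite leq_eqVlt; apply/orP; left; apply/eqP; apply: eq_bigr => A _.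
by congr (P _); apply: eq_imset => i; rewrite ffunE.
Qed.

Lemma lt_Sigma_fibres (s q : nat) (x0 : V) : q < Sigma P s ->
  exists2 x : V -> nat, \sum_a x a = s &
    2 * q < \sum_a \sum_b x a * x b * P [set a; b]%SET.
Proof.
move=> qS.
have [f fq] : exists f : {ffun 'I_s -> V},
    q < esize (fun A : {set 'I_s} => P (f @: A)%SET).
  apply: contrapT => H; move: qS; rewrite (SigmaE _ _ x0) ltnNge => /negP; apply.
  apply/bigmax_leqP => f _; rewrite leqNgt; apply/negP => h; apply: H; by exists f.
exists (fun a => #|[set i | f i == a]%SET|).
  have := sum_fibres f (fun=> 1); rewrite sum1_card card_ord => sE.
  by rewrite [RHS]sE; apply: eq_bigr => a _; rewrite muln1.
apply: (@leq_trans (2 * esize (fun A : {set 'I_s} => P (f @: A)%SET))); first lia.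
rewrite -sum_adjT.
under eq_bigr do under eq_bigr do rewrite adj_blowup.
rewrite (sum_fibres f (fun a => \sum_j P [set a; f j]%SET)).
apply: leq_sum => a _; rewrite (sum_fibres f (fun b => P [set a; b]%SET)) big_distrr /=.
by apply: leq_sum => b _; rewrite mulnA.
Qed.

(** Every residue class modulo [d] has at least [n %/ d] elements below [n]. *)
Lemma sum_modn_ge (n d : nat) (d0 : 0 < d) (h : 'I_d -> nat) :
  n %/ d * \sum_i h i <= \sum_(u < n) h (Ordinal (ltn_pmod u d0)).
Proof.
rewrite (sum_fibres (fun u : 'I_n => Ordinal (ltn_pmod u d0)) h) big_distrr /=.
apply: leq_sum => i _; rewrite leq_mul2r; apply/orP; right.
have lt_n (j : 'I_(n %/ d)) : j * d + i < n.
  apply: leq_trans (leq_trunc_div n d); case: j => j /= jn; case: i => i /= id; nia.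
pose g j := Ordinal (lt_n j).
have gi : injective g.
  move=> j j' /(congr1 val) /= /eqP; rewrite eqn_add2r eqn_pmul2r // => /eqP.
  exact: val_inj.
rewrite -[n %/ d]card_ord -(card_imset _ gi); apply: subset_leq_card.
apply/fintype.subsetP => u /imsetP[j _ ->]; rewrite inE; apply/eqP; apply: val_inj.
by rewrite /= modnMDl modn_small.
Qed.

(** Vertex [u] goes to the part [g] of its residue modulo [d], so [g] encodes part sizes in rational
    proportions. Every [s]-subset of the resulting blow-up is itself a blow-up on [s] vertices,
    hence has at most [Sigma P s] edges. *)
Lemma exSigma_ge_blowup (s q d n : nat) (g : 'I_d -> V) (x0 : V) :
  2 <= s -> s <= n -> 0 < d -> Sigma P s <= q ->
  (n %/ d) ^ 2 * (\sum_i \sum_j P [set g i; g j]%SET) <= 2 * exSigma n s q.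
Proof.
move=> s2 sn d0 Sq.
pose f (u : 'I_n) := g (Ordinal (ltn_pmod u d0)).
pose w : multigraph 'I_n := fun A => P (f @: A)%SET.
have ws : sq_graph s q w.
  move=> X Xs; rewrite -(leq_pmul2l (isT : 0 < 2)).
  pose x (i : 'I_s) := enum_val (cast_ord (esym Xs) i).
  have xi : injective x by move=> i j /enum_val_inj/cast_ord_inj.
  have -> : X = (x @: 'I_s)%SET.
    apply/eqP; rewrite eq_sym eqEcard card_imset // card_ord Xs leqnn andbT.
    by apply/fintype.subsetP => u /imsetP[i _ ->]; apply: enum_valP.
  rewrite -sum_adj_inj //.
  under eq_bigr do under eq_bigr do rewrite adj_blowup.
  apply: leq_trans (blowup_le_Sigma (f \o x) x0) _.
  by rewrite leq_mul2l.
apply: leq_trans (leq_mul (leqnn 2) ((exSigmaP q s2 sn).2 w ws)).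
rewrite -sum_adjT.
under [leqRHS]eq_bigr do under eq_bigr do rewrite adj_blowup.
apply: leq_trans (sum_modn_ge n d0 (fun i => \sum_v P [set g i; f v]%SET)).
rewrite expnS expn1 -mulnA leq_mul2l big_distrr /=; apply/orP; right.
by apply: leq_sum => i _; exact: (sum_modn_ge n d0 (fun j => P [set g i; g j]%SET)).
Qed.

End GraphPattern.

(** * Stars and the path in coordinates *)

Lemma set2_inj_eq (T : finType) (a b c d : T) :
  ([set a; b] == [set c; d])%SET =
  ((a == c) && (b == d)) || ((a == d) && (b == c)).
Proof.
apply/eqP/orP => [h|[] /andP[/eqP-> /eqP->] //]; last by rewrite finset.setUC.
have /set2P ha : a \in [set c; d]%SET by rewrite -h finset.set21.
have /set2P hb : b \in [set c; d]%SET by rewrite -h finset.set22.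
have /set2P hc : c \in [set a; b]%SET by rewrite h finset.set21.
have /set2P hd : d \in [set a; b]%SET by rewrite h finset.set22.
case: ha hb hc hd => -> [->|->] hc hd; rewrite ?eqxx; [|by left|by right|].
- by left; case: hd => ->; rewrite !eqxx.
- by right; case: hc => ->; rewrite !eqxx.
Qed.

(** Weights on naturals rather than ordinals, so that concrete sums can be evaluated. *)
Definition star_weight (a b : nat) : nat :=
  if a == b then 0 else if (a == 0) || (b == 0) then 2 else 1.

Definition path_weight (a b : nat) : nat :=
  if a == b then 0 else if (a.+1 == b) || (b.+1 == a) then 2 else 1.

Lemma star_patternE l (a b : 'I_l.+1) :
  graph_pattern (star l) 1 [set a; b]%SET = star_weight a b.
Proof.
rewrite /star_weight; have [->|ab] := eqVneq a b.
  by rewrite eqxx graph_pattern1_loop.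
have nab : (a == b :> nat) = false by apply/negbTE; rewrite val_eqE.
rewrite /graph_pattern cards2 ab nab /=.
congr (if _ then _ else _); apply/imsetP/orP => [[i _ /eqP]|].
  rewrite set2_inj_eq => /orP[] /andP[/eqP-> /eqP->]; by [left|right].
case: (unliftP ord0 a) => [i aE|aE]; case: (unliftP ord0 b) => [j bE|bE];
  rewrite {1}aE {1}bE /=.
- by case.
- by exists i; rewrite // aE bE finset.setUC.
- by exists j; rewrite // aE bE.
- by rewrite aE bE eqxx in ab.
Qed.

Lemma path_patternE (a b : 'I_4) :
  graph_pattern path4 1 [set a; b]%SET = path_weight a b.
Proof.
rewrite /path_weight; have [->|ab] := eqVneq a b.
  by rewrite eqxx graph_pattern1_loop.
have nab : (a == b :> nat) = false by apply/negbTE; rewrite val_eqE.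
rewrite /graph_pattern cards2 ab nab /=.
congr (if _ then _ else _); apply/imsetP/orP => [[i _ /eqP]|].
  by rewrite set2_inj_eq => /orP[] /andP[/eqP-> /eqP->]; [left|right].
case=> /eqP h.
- have i3 : a < 3 by have := ltn_ord b; lia.
  exists (Ordinal i3) => //; congr [set _; _]%SET; exact: val_inj.
- have i3 : b < 3 by have := ltn_ord a; lia.
  exists (Ordinal i3) => //; rewrite finset.setUC; congr [set _; _]%SET; exact: val_inj.
Qed.

(** The part sizes of an optimal blow-up violate the inequality. This is the form in which the upper
    bounds on [q] enter. *)
Lemma not_fits_star2 s q :
  q < Sigma (graph_pattern (star 2) 1) s -> ~ fits_star2 s q.
Proof.
move=> /(@lt_Sigma_fibres _ _ s q ord0)[x xs].
under eq_bigr do under eq_bigr do rewrite star_patternE.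
rewrite !big_ord_recl !big_ord0 /= in xs *.
move=> h H; have := H _ _ _ (etrans (esym (addnA _ _ _)) xs).
move: h; rewrite /star_weight /=; lia.
Qed.

Lemma not_fits_star3 s q :
  q < Sigma (graph_pattern (star 3) 1) s -> ~ fits_star3 s q.
Proof.
move=> /(@lt_Sigma_fibres _ _ s q ord0)[x xs].
under eq_bigr do under eq_bigr do rewrite star_patternE.
rewrite !big_ord_recl !big_ord0 /= addn0 !addnA in xs *.
move=> h /(_ _ _ _ _ xs); move: h; rewrite /star_weight /=; lia.
Qed.

Lemma not_fits_star4 s q :
  q < Sigma (graph_pattern (star 4) 1) s -> ~ fits_star4 s q.
Proof.
move=> /(@lt_Sigma_fibres _ _ s q ord0)[x xs].
under eq_bigr do under eq_bigr do rewrite star_patternE.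
rewrite !big_ord_recl !big_ord0 /= addn0 !addnA in xs *.
move=> h /(_ _ _ _ _ _ xs); move: h; rewrite /star_weight /=; lia.
Qed.

Lemma not_fits_path4 s q :
  q < Sigma (graph_pattern path4 1) s -> ~ fits_path4 s q.
Proof.
move=> /(@lt_Sigma_fibres _ _ s q ord0)[x xs].
under eq_bigr do under eq_bigr do rewrite path_patternE.
rewrite !big_ord_recl !big_ord0 /= addn0 !addnA in xs *.
move=> h /(_ _ _ _ _ xs); move: h; rewrite /path_weight /=; lia.
Qed.

(** * Lower bounds on the densities *)

Lemma exSigma_ge_quadratic (R : realType) (V : finType) (E : {set {set V}})
    (s q d n : nat) (g : 'I_d -> V) (x0 : V) :
  2 <= s -> s <= n -> d <= n -> 0 < d -> Sigma (graph_pattern E 1) s <= q ->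
  ((\sum_i \sum_j graph_pattern E 1 [set g i; g j]%SET)%:R / d%:R ^+ 2 *
     (n%:R - d%:R) ^+ 2 <= (2 * exSigma n s q)%:R :> R)%R.
Proof.
move=> s2 sn dn d0 /(exSigma_ge_blowup g x0 s2 sn d0).
set T := \sum_i _ => h.
have {}h : ((n %/ d)%:R ^+ 2 * T%:R <= (2 * exSigma n s q)%:R :> R)%R.
  by rewrite -natrX -natrM ler_nat.
apply: le_trans h.
have d0' : (0 < d%:R :> R)%R by rewrite ltr0n.
rewrite mulrAC -mulrA.
rewrite [leRHS]mulrC; apply: ler_wpM2l; first by rewrite ler0n.
rewrite -expr_div_n lerXn2r ?nnegrE ?ler0n //.
  by rewrite divr_ge0 ?ler0n // subr_ge0 ler_nat.
rewrite ler_pdivrMr // lerBlDr -natrM -natrD ler_nat.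
have := divn_eq n d; have := ltn_pmod n d0; lia.
Qed.

Lemma star2_density (R : realType) (s q n : nat) : 2 <= s -> s <= n -> 7 <= n ->
  Sigma (graph_pattern (star 2) 1) s <= q ->
  ((1 + 1 / 7) * (n%:R - 7%:R) ^+ 2 <= (2 * exSigma n s q)%:R :> R)%R.
Proof.
move=> s2 sn n7 Sq.
(* Centre and leaves in proportion 3:2:2 have ordered weight 56, and 56/49 = 1 + 1/7. The next two
   lemmas use 42/36 and 30/25 in the same way. *)
pose F k := nth 0 [:: 0; 0; 0; 1; 1; 2; 2] k.
have := @exSigma_ge_quadratic R _ _ s q 7 n (fun i => inord (F i)) ord0 s2 sn n7 isT Sq.
congr (is_true (_ * _ <= _)%R).
have -> : \sum_(i < 7) \sum_(j < 7)
    graph_pattern (star 2) 1 [set inord (F i); inord (F j)]%SET = 56.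
  transitivity (\sum_(0 <= i < 7) \sum_(0 <= j < 7) star_weight (F i) (F j)).
    rewrite big_mkord; apply: eq_bigr => i _; rewrite big_mkord.
    apply: eq_bigr => j _; rewrite star_patternE !inordK //.
    - by case: j => [] [|[|[|[|[|[|[|?]]]]]]].
    - by case: i => [] [|[|[|[|[|[|[|?]]]]]]].
  by rewrite unlock.
by field.
Qed.

Lemma path4_density (R : realType) (s q n : nat) : 2 <= s -> s <= n -> 6 <= n ->
  Sigma (graph_pattern path4 1) s <= q ->
  ((1 + 1 / 6) * (n%:R - 6%:R) ^+ 2 <= (2 * exSigma n s q)%:R :> R)%R.
Proof.
move=> s2 sn n6 Sq.
pose F k := nth 0 [:: 0; 1; 1; 2; 2; 3] k.
have := @exSigma_ge_quadratic R _ _ s q 6 n (fun i => inord (F i)) ord0 s2 sn n6 isT Sq.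
congr (is_true (_ * _ <= _)%R).
have -> : \sum_(i < 6) \sum_(j < 6)
    graph_pattern path4 1 [set inord (F i); inord (F j)]%SET = 42.
  transitivity (\sum_(0 <= i < 6) \sum_(0 <= j < 6) path_weight (F i) (F j)).
    rewrite big_mkord; apply: eq_bigr => i _; rewrite big_mkord.
    apply: eq_bigr => j _; rewrite path_patternE !inordK //.
    - by case: j => [] [|[|[|[|[|[|?]]]]]].
    - by case: i => [] [|[|[|[|[|[|?]]]]]].
  by rewrite unlock.
by field.
Qed.

Lemma star3_density (R : realType) (s q n : nat) : 2 <= s -> s <= n -> 5 <= n ->
  Sigma (graph_pattern (star 3) 1) s <= q ->
  ((1 + 1 / 5) * (n%:R - 5%:R) ^+ 2 <= (2 * exSigma n s q)%:R :> R)%R.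
Proof.
move=> s2 sn n5 Sq.
pose F k := nth 0 [:: 0; 0; 1; 2; 3] k.
have := @exSigma_ge_quadratic R _ _ s q 5 n (fun i => inord (F i)) ord0 s2 sn n5 isT Sq.
congr (is_true (_ * _ <= _)%R).
have -> : \sum_(i < 5) \sum_(j < 5)
    graph_pattern (star 3) 1 [set inord (F i); inord (F j)]%SET = 30.
  transitivity (\sum_(0 <= i < 5) \sum_(0 <= j < 5) star_weight (F i) (F j)).
    rewrite big_mkord; apply: eq_bigr => i _; rewrite big_mkord.
    apply: eq_bigr => j _; rewrite star_patternE !inordK //.
    - by case: j => [] [|[|[|[|[|?]]]]].
    - by case: i => [] [|[|[|[|[|?]]]]].
  by rewrite unlock.
by field.
Qed.

(** All pairs get multiplicity 1; (n - 1)^2 <= n (n - 1) gives the common shape with d = 1. *)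
Lemma constant1_density (R : realType) (s q n : nat) : 2 <= s -> s <= n ->
  'C(s, 2) <= q ->
  (1 * (n%:R - 1%:R) ^+ 2 <= (2 * exSigma n s q)%:R :> R)%R.
Proof.
move=> s2 sn Cq.
pose w : multigraph 'I_n := fun=> 1.
have wE X : esum_in w X = 'C(#|X|, 2).
  by rewrite /esum_in sum1dep_card -cards_draws; congr #|pred_of_set _|;
    apply/setP => A; rewrite !inE andbC.
have ws : sq_graph s q w by move=> X Xs; rewrite wE Xs.
have := (exSigmaP q s2 sn).2 w ws; rewrite /esize wE cardsT card_ord => h.
rewrite mul1r -natrB; last lia.
rewrite -natrX ler_nat (leq_trans _ (leq_mul (leqnn 2) h)) //.
have := mul_bin_diag n 1; rewrite bin1 => <-; rewrite expnS expn1; nia.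
Qed.

(** * Graphs without C3, C4 and induced 2K2 *)

Section SmallGraphs.
Variables (T : finType) (e : rel T).
Hypothesis eC : forall a b, e a b -> e b a.
Hypothesis noK3 : forall a b c, e a b -> e b c -> e c a -> False.
Hypothesis noC4 : forall a b c d, e a b -> e b c -> e c d -> e d a ->
  a <> c -> b <> d -> False.
Hypothesis no2K2 : forall a b c d, e a b -> e c d -> a <> c -> a <> d ->
  b <> c -> b <> d -> [\/ e a c, e a d, e b c | e b d].

Definition cycle5 a b c d f := [/\ e a b, e b c, e c d, e d f & e f a].

Lemma cycle5_rot a b c d f : cycle5 a b c d f -> cycle5 b c d f a.
Proof. by case. Qed.

Lemma cycle5_neq2 a b c d f : cycle5 a b c d f -> a <> c /\ a <> d.
Proof.
case=> ab bc cd df fa; split=> E; subst.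
- exact: (noK3 cd df fa).
- exact: (noK3 ab bc cd).
Qed.

(** The edge [y a] and the opposite edge [c d] of the cycle must be joined, and each of the four
    possible joining edges closes a triangle or a 4-cycle. *)
Lemma cycle5_no_pendant0 a b c d f y : cycle5 a b c d f ->
  y \notin [:: a; b; c; d; f] -> ~ e y a.
Proof.
move=> C; rewrite !inE !negb_or => /and5P[_ /eqP nb /eqP nc /eqP nd /eqP nf] ya.
have [ab bc cd df fa] := C; have [nac nad] := cycle5_neq2 C.
have [yc|yd|ac|ad] := no2K2 ya cd nc nd nac nad.
- exact: (noC4 ya ab bc (eC yc)).
- exact: (noC4 ya (eC fa) (eC df) (eC yd)).
- exact: (noK3 ab bc (eC ac)).
- exact: (noK3 ad df fa).
Qed.

Lemma cycle5_no_pendant a b c d f y z : cycle5 a b c d f ->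
  y \notin [:: a; b; c; d; f] -> z \in [:: a; b; c; d; f] -> ~ e y z.
Proof.
move=> C1; have C2 := cycle5_rot C1; have C3 := cycle5_rot C2.
have C4 := cycle5_rot C3; have C5 := cycle5_rot C4.
rewrite !inE !negb_or => /and5P[na nb nc nd nf].
case/or4P=> [/eqP->|/eqP->|/eqP->|/orP[/eqP->|/eqP->]].
- by apply: (cycle5_no_pendant0 C1); rewrite !inE !negb_or; apply/and5P.
- by apply: (cycle5_no_pendant0 C2); rewrite !inE !negb_or; apply/and5P.
- by apply: (cycle5_no_pendant0 C3); rewrite !inE !negb_or; apply/and5P.
- by apply: (cycle5_no_pendant0 C4); rewrite !inE !negb_or; apply/and5P.
- by apply: (cycle5_no_pendant0 C5); rewrite !inE !negb_or; apply/and5P.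
Qed.

(** An edge avoiding the cycle would have to be joined to [a b], which produces either a pendant
    edge or an endpoint on the cycle. *)
Lemma cycle5_covers a b c d f u v : cycle5 a b c d f -> e u v ->
  u \in [:: a; b; c; d; f].
Proof.
move=> C uv; have [ab bc cd df fa] := C.
apply: contraT => nu; exfalso.
have uN z : z \in [:: a; b; c; d; f] -> ~ e u z by apply: cycle5_no_pendant C nu.
have [vC|nv] := boolP (v \in [:: a; b; c; d; f]); first exact: (uN v).
have vN z : z \in [:: a; b; c; d; f] -> ~ e v z by apply: cycle5_no_pendant C nv.
have ain : a \in [:: a; b; c; d; f] by rewrite !inE eqxx.
have bin : b \in [:: a; b; c; d; f] by rewrite !inE eqxx orbT.
have neq y z : y \notin [:: a; b; c; d; f] -> z \in [:: a; b; c; d; f] -> y <> z.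
  by move=> yn zi E; rewrite E zi in yn.
by case: (no2K2 uv ab (neq _ _ nu ain) (neq _ _ nu bin) (neq _ _ nv ain)
  (neq _ _ nv bin)) => h; [exact: (uN _ ain h)|exact: (uN _ bin h)
  |exact: (vN _ ain h)|exact: (vN _ bin h)].
Qed.

(** For an edge [b c] of a triangle-free graph this describes a double star with centres [b] and
    [c]. *)
Definition edge_cover b c := forall u v, e u v ->
  [\/ u = b, u = c, v = b | v = c].

(** If there is a path a b c d, its middle edge meets all edges: an edge missing it would be joined
    to it and then close a 3-, 4- or 5-cycle with the path. If there is none, any edge will do,
    since an edge missing it would be joined to it and create such a path. *)
Lemma cover_or_cycle5 :
  [\/ forall u v, ~ e u v, exists b c, e b c /\ edge_cover b c |
     exists a b c d f, cycle5 a b c d f].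
Proof.
have [[b0 [c0 bc0]]|noE] := EM (exists b c, e b c); last first.
  by constructor 1 => u v uv; apply: noE; exists u, v.
have [C5|noC5] := EM (exists a b c d f, cycle5 a b c d f); first by constructor 3.
constructor 2.
have [[a [b [c [d [ab bc cd nac nbd]]]]]|noP4] := EM (exists a b c d,
  [/\ e a b, e b c, e c d, a <> c & b <> d]).
  (* Here [u v] hangs at the vertex [b'] of the path b' c' d'. Comparing [u v] with [c' d'] closes a
     cycle of length 3, 4 or 5 in each case. *)
  have step b' c' d' u v : e b' c' -> e c' d' -> b' <> d' -> e u v -> e u b' ->
      u <> c' -> v <> b' -> v <> c' -> False.
    move=> bc' cd' nbd' uv ub nuc nvb nvc; have nbv := nesym nvb.
    have nud : u <> d'.
      by move=> E; rewrite -E in cd'; exact: (noK3 ub bc' cd').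
    have nvd : v <> d'.
      by move=> E; rewrite -E in cd'; exact: (noC4 ub bc' cd' (eC uv)).
    have [vc|vd|uc|ud] := no2K2 (eC uv) cd' nvc nvd nuc nud.
    - exact: (noC4 ub bc' (eC vc) (eC uv)).
    - by apply: noC5; exists v, u, b', c', d'; split=> //; exact: eC.
    - exact: (noK3 ub bc' (eC uc)).
    - exact: (noC4 ub bc' cd' (eC ud)).
  exists b, c; split=> // u v uv; apply: contrapT => nC.
  have nub : u <> b by move=> h; apply: nC; constructor 1.
  have nuc : u <> c by move=> h; apply: nC; constructor 2.
  have nvb : v <> b by move=> h; apply: nC; constructor 3.
  have nvc : v <> c by move=> h; apply: nC; constructor 4.
  have nca : c <> a by apply: nesym.
  have vu := eC uv; have cb := eC bc; have ba := eC ab.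
  have [ub|uc|vb|vc] := no2K2 uv bc nub nuc nvb nvc.
  - exact: (step _ _ _ _ _ bc cd nbd uv ub).
  - exact: (step _ _ _ _ _ cb ba nca uv uc).
  - exact: (step _ _ _ _ _ bc cd nbd vu vb).
  - exact: (step _ _ _ _ _ cb ba nca vu vc).
exists b0, c0; split=> // u v uv; apply: contrapT => nC.
have nub : u <> b0 by move=> h; apply: nC; constructor 1.
have nuc : u <> c0 by move=> h; apply: nC; constructor 2.
have nvb : v <> b0 by move=> h; apply: nC; constructor 3.
have nvc : v <> c0 by move=> h; apply: nC; constructor 4.
have vu := eC uv; have cb0 := eC bc0.
have [ub|uc|vb|vc] := no2K2 uv bc0 nub nuc nvb nvc; apply: noP4.
- by exists v, u, b0, c0.
- by exists v, u, c0, b0.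
- by exists u, v, b0, c0.
- by exists u, v, c0, b0.
Qed.
End SmallGraphs.

(** * Lagrangians *)

Section QuadraticForm.
Local Open Scope ring_scope.
Variables (R : realFieldType) (m : nat) (W : 'I_m -> 'I_m -> nat).
Hypothesis WC : forall i j, W i j = W j i.
Implicit Types x y d : 'I_m -> R.

Definition bform x y : R := \sum_i (\sum_j (W i j)%:R * x j) * y i.

Lemma bformC x y : bform x y = bform y x.
Proof.
rewrite /bform; under eq_bigr do rewrite mulr_suml.
rewrite exchange_big /=; apply: eq_bigr => j _; rewrite mulr_suml.
by apply: eq_bigr => i _; rewrite WC mulrAC.
Qed.

Lemma bform_shift x d (t : R) :
  bform (fun i => x i + t * d i) (fun i => x i + t * d i) =
  bform x x + 2 * t * bform x d + t ^+ 2 * bform d d.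
Proof.
have lin y : bform (fun i => x i + t * d i) y = bform x y + t * bform d y.
  rewrite /bform mulr_sumr -big_split /=; apply: eq_bigr => i _.
  rewrite mulrA -mulrDl; congr (_ * _); rewrite mulr_sumr -big_split /=.
  by apply: eq_bigr => j _; ring.
rewrite lin (bformC x) (bformC d) !lin (bformC d x); ring.
Qed.

(* The quadratic form is convex along d, so one of the two half-lines from x
   in direction d does not decrease it; follow it until a coordinate
   vanishes. *)
Lemma support_shrink x d : (forall i, 0 <= x i) ->
  (forall i, d i != 0 -> 0 < x i) -> \sum_i d i = 0 ->
  (exists i, d i != 0) -> 0 <= bform d d ->
  exists x', [/\ forall i, 0 <= x' i, \sum_i x' i = \sum_i x i,
    forall i, x i = 0 -> x' i = 0, exists2 i, 0 < x i & x' i = 0 &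
    bform x x <= bform x' x'].
Proof.
move=> x0; wlog xd : d / 0 <= bform x d.
  move=> H dx ds dn dd; have [/H|/ltW xd] := leP 0 (bform x d); first exact.
  have dN : bform x (fun i => - d i) = - bform x d.
    by rewrite /bform -sumrN; apply: eq_bigr => i _; rewrite mulrN.
  apply: (H (fun i => - d i)); rewrite ?dN ?oppr_ge0 //.
  - by move=> i; rewrite oppr_eq0; apply: dx.
  - by rewrite sumrN ds oppr0.
  - by have [i di] := dn; exists i; rewrite oppr_eq0.
  - have -> : bform (fun i => - d i) (fun i => - d i) = bform d d => //.
    rewrite /bform; apply: eq_bigr => i _; rewrite mulrN -mulNr -sumrN.
    by congr (_ * _); apply: eq_bigr => j _; rewrite mulrN opprK.
move=> dx ds [i1 di1] dd.
have [i0 di0] : exists i0, d i0 < 0.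
  apply: contrapT => H.
  have d0 i : 0 <= d i by rewrite leNgt; apply/negP => di; apply: H; exists i.
  have /(_ i1 isT)/eqP := @psumr_eq0P _ _ predT d (fun i _ => d0 i) ds.
  by rewrite (negPf di1).
case: (@Order.TotalTheory.arg_minP _ _ _ i0 (fun i => d i < 0)
  (fun i => x i / - d i) di0) => i di imin.
pose t := x i / - d i.
have xi : 0 < x i by apply: dx; rewrite lt_eqF.
have t0 : 0 < t by rewrite divr_gt0 // oppr_gt0.
exists (fun j => x j + t * d j); split.
- move=> j; have [dj|dj] := leP 0 (d j).
    by apply: addr_ge0 => //; apply: mulr_ge0 => //; exact: ltW.
  have := imin j dj; rewrite -/t ler_pdivlMr ?oppr_gt0 // mulrN => h.
  by rewrite -lerBlDr sub0r.
- by rewrite big_split /= -mulr_sumr ds mulr0 addr0.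
- move=> j xj; have [->|/dx] := eqVneq (d j) 0; first by rewrite xj mulr0 addr0.
  by rewrite xj ltxx.
- exists i => //; rewrite /t; field; by rewrite lt_eqF.
- rewrite bform_shift -addrA lerDl; apply: addr_ge0; apply: mulr_ge0 => //.
  + by apply: mulr_ge0 => //; exact: ltW.
  + by apply: exprn_ge0; exact: ltW.
Qed.

Definition indic (a : 'I_m) : 'I_m -> R := fun i => (i == a)%:R.

Lemma sum_indic a (F : 'I_m -> R) : \sum_j F j * indic a j = F a.
Proof.
rewrite (bigD1 a) //= /indic eqxx mulr1 big1 ?addr0 // => j /negPf ->.
by rewrite mulr0.
Qed.

Lemma sum_indic2 (a b c d : 'I_m) (F : 'I_m -> R) :
  \sum_j F j * (indic a j + indic b j - indic c j - indic d j) =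
  F a + F b - F c - F d.
Proof.
rewrite -(sum_indic a F) -(sum_indic b F) -(sum_indic c F) -(sum_indic d F).
by rewrite -big_split -!sumrB /=; apply: eq_bigr => j _; ring.
Qed.

Definition reduced x := (forall i j, i != j -> 0 < x i -> 0 < x j -> (0 < W i j)%N) /\
  forall a b c d : 'I_m, 0 < x a -> 0 < x b -> 0 < x c -> 0 < x d ->
    W a b = 2 -> W c d = 2 -> W a c = 1 -> W a d = 1 -> W b c = 1 -> W b d = 1 -> False.

Hypothesis W0 : forall i, W i i = 0.

(** Induction on the size of the support. A violation of [reduced] gives a direction of zero
    curvature inside the support, along which [support_shrink] removes a point. *)
Lemma bform_reduced_le (lam : R) :
  (forall x, (forall i, 0 <= x i) -> reduced x ->
     bform x x <= lam * (\sum_i x i) ^+ 2) ->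
  forall x, (forall i, 0 <= x i) -> bform x x <= lam * (\sum_i x i) ^+ 2.
Proof.
move=> H x; have [k] := ubnP #|[set i | 0 < x i]%SET|.
elim: k x => // k IH x xk x0.
(* Coincidences a = b and c = d are allowed, so that one direction serves both a pair of
   multiplicity 0 and two unlinked heavy edges. *)
suff dir (a b c d : 'I_m) : 0 < x a -> 0 < x b -> 0 < x c -> 0 < x d ->
    a != c -> a != d -> 
    0 <= bform (fun j => indic a j + indic b j - indic c j - indic d j)
      (fun j => indic a j + indic b j - indic c j - indic d j) ->
    bform x x <= lam * (\sum_i x i) ^+ 2.
  have [|nred] := EM (reduced x); first exact: H.
  have [r1|nr1] := EM (forall i j, i != j -> 0 < x i -> 0 < x j -> (0 < W i j)%N).
    have [r2|] := EM (forall a b c d : 'I_m, 0 < x a -> 0 < x b -> 0 < x c -> 0 < x d ->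
      W a b = 2 -> W c d = 2 -> W a c = 1 -> W a d = 1 -> W b c = 1 -> W b d = 1 -> False).
      by case: nred.
    move=> nr2; apply: contrapT => nle; apply: nr2.
    move=> a b c d xa xb xc xd ab cd ac ad bc bd.
    have nac : a != c by apply/eqP => E; rewrite E W0 in ac.
    have nad : a != d by apply/eqP => E; rewrite E W0 in ad.
    apply: nle; apply: (dir a b c d) => //.
    rewrite /bform; under eq_bigr do rewrite sum_indic2.
    rewrite sum_indic2 !W0 (WC b a) (WC c a) (WC c b) (WC d a) (WC d b) (WC d c).
    by rewrite ab cd ac ad bc bd; lra.
  apply: contrapT => nle; apply: nr1 => i j ij xi xj; rewrite lt0n; apply/eqP => Wij.
  apply: nle; apply: (dir i i j j) => //.
  rewrite /bform; under eq_bigr do rewrite sum_indic2.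
  by rewrite sum_indic2 !W0 (WC j i) Wij; lra.
move=> xa xb xc xd ac ad dd.
have [|||x' [x'0 x's x'x [i xi x'i] le]] := support_shrink x0 _ _ _ dd.
- move=> i; rewrite /indic.
  have [->|_] := eqVneq i a; first by [].
  have [->|_] := eqVneq i b; first by [].
  have [->|_] := eqVneq i c; first by [].
  have [->|_] := eqVneq i d; first by [].
  by rewrite /= !subr0 addr0 eqxx.
- have := sum_indic2 a b c d (fun=> 1); under eq_bigr do rewrite mul1r.
  by move=> ->; ring.
- exists a; rewrite /indic eqxx (negPf ac) (negPf ad) /= !subr0.
  by rewrite lt0r_neq0 // ltr_pwDl // ler0n.
apply: le_trans le _; rewrite -x's; apply: IH => //.
apply: (@leq_trans #|[set i | 0 < x i]%SET|); last by rewrite -ltnS.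
apply: proper_card; apply/properP; split.
  apply/fintype.subsetP => j; rewrite !inE => x'j; rewrite lt_neqAle x0 andbT eq_sym.
  by apply/eqP => /x'x E; rewrite E ltxx in x'j.
by exists i; rewrite !inE ?x'i ?ltxx.
Qed.

(** Cauchy-Schwarz, from the nonnegativity of the sum of all (x i - x j)^2. *)
Lemma sum_sqr_le (N : {set 'I_m}) (k : nat) x : (#|N| <= k)%N ->
  (\sum_(i in N) x i) ^+ 2 <= k%:R * \sum_(i in N) x i ^+ 2.
Proof.
move=> Nk; set A := \sum_(i in N) x i; set Q := \sum_(i in N) x i ^+ 2.
have Q0 : 0 <= Q by apply: sumr_ge0 => i _; apply: sqr_ge0.
apply: (@le_trans _ _ (#|N|%:R * Q)); last by rewrite ler_wpM2r // ler_nat.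
have h : 0 <= \sum_(i in N) \sum_(j in N) (x i - x j) ^+ 2.
  by apply: sumr_ge0 => i _; apply: sumr_ge0 => j _; apply: sqr_ge0.
have E : \sum_(i in N) \sum_(j in N) (x i - x j) ^+ 2 =
    2 * (#|N|%:R * Q) - 2 * A ^+ 2.
  transitivity (\sum_(i in N) (#|N|%:R * x i ^+ 2 - 2 * A * x i + Q)).
    apply: eq_bigr => i _.
    rewrite (eq_bigr (fun j => x i ^+ 2 - (2 * x i) * x j + x j ^+ 2)); last first.
      by move=> j _; ring.
    by rewrite big_split /= sumrB sumr_const -mulr_sumr -mulr_natl -/A -/Q; ring.
  rewrite big_split /= sumrB -!mulr_sumr sumr_const -/A -/Q -mulr_natl; ring.
by lra.
Qed.

End QuadraticForm.

(** * Bounding the form by the shape of the heavy edges *)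

Section Bound.
Local Open Scope ring_scope.
Variables (R : realFieldType) (m : nat) (W : 'I_m -> 'I_m -> nat).
Implicit Types (x : 'I_m -> R) (P Q : {set 'I_m}).

Lemma sum_disjoint_le (l : seq {set 'I_m}) (F : 'I_m -> R) :
  (forall i, 0 <= F i) ->
  (forall i, (\sum_(P <- l) (i \in P) <= 1)%N) ->
  \sum_(P <- l) \sum_(i in P) F i <= \sum_i F i.
Proof.
move=> F0 l1; under eq_bigr do rewrite big_mkcond.
rewrite exchange_big /=; apply: ler_sum => i _.
have -> : \sum_(P <- l) (if i \in P then F i else 0) =
    (\sum_(P <- l) (i \in P))%:R * F i.
  rewrite natr_sum mulr_suml; apply: eq_bigr => P _.
  by case: ifP; rewrite ?mul1r ?mul0r.
by rewrite -[leRHS]mul1r ler_wpM2r // lern1.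
Qed.

(** The all-ones matrix with zero diagonal gives the first two terms; each listed pair of sets adds
    the product of their weights, once for each order. The entrywise bound is asked on the support
    only, as all other terms vanish. *)
Lemma bform_le_sets (l : seq ({set 'I_m} * {set 'I_m})) x :
  (forall i, 0 <= x i) ->
  (forall i j, 0 < x i -> 0 < x j -> (W i j <= (i != j) +
     \sum_(pr <- l) ((i \in pr.1) && (j \in pr.2) +
                     ((i \in pr.2) && (j \in pr.1))))%N) ->
  bform W x x <= (\sum_i x i) ^+ 2 - \sum_i x i ^+ 2 +
    2 * \sum_(pr <- l) (\sum_(i in pr.1) x i) * (\sum_(i in pr.2) x i).
Proof.
move=> x0 H.
pose I P i : R := (i \in P)%:R.
have sumI P : \sum_i I P i * x i = \sum_(i in P) x i.
  rewrite [RHS]big_mkcond; apply: eq_bigr => i _; rewrite /I.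
  by case: (i \in P); rewrite ?mul1r ?mul0r.
have prodI P Q : \sum_i \sum_j (I P i * I Q j) * (x j * x i) =
    (\sum_(i in P) x i) * (\sum_(i in Q) x i).
  rewrite -!sumI mulr_suml; apply: eq_bigr => i _; rewrite mulr_sumr.
  by apply: eq_bigr => j _; ring.
apply: (@le_trans _ _ (\sum_i \sum_j ((1 - (i == j)%:R) * (x j * x i) +
  \sum_(pr <- l) ((I pr.1 i * I pr.2 j) * (x j * x i) +
    (I pr.2 i * I pr.1 j) * (x j * x i))))).
  rewrite /bform; apply: ler_sum => i _; rewrite mulr_suml; apply: ler_sum => j _.
  have -> : (1 - (i == j)%:R) * (x j * x i) +
    \sum_(pr <- l) ((I pr.1 i * I pr.2 j) * (x j * x i) +
      (I pr.2 i * I pr.1 j) * (x j * x i)) =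
    ((i != j) + \sum_(pr <- l) ((i \in pr.1) && (j \in pr.2) +
                     ((i \in pr.2) && (j \in pr.1))))%N%:R * (x j * x i).
    rewrite natrD natr_sum [RHS]mulrDl mulr_suml; congr (_ + _).
      by case: eqP => _ /=; rewrite ?subrr ?subr0.
    by apply: eq_bigr => pr _; rewrite natrD -!mulnb !natrM mulrDl.
  rewrite -mulrA.
  have [xi|xi] := eqVneq (x i) 0; first by rewrite xi !mulr0.
  have [xj|xj] := eqVneq (x j) 0; first by rewrite xj !mul0r !mulr0.
  rewrite ler_wpM2r ?mulr_ge0 // ler_nat H //.
  - by rewrite lt_neqAle eq_sym xi x0.
  - by rewrite lt_neqAle eq_sym xj x0.
rewrite le_eqVlt; apply/orP; left; apply/eqP.
under eq_bigr do rewrite big_split /=.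
rewrite big_split /=; congr (_ + _).
  rewrite expr2 mulr_suml -sumrB; apply: eq_bigr => i _.
  under eq_bigr do rewrite mulrBl mul1r.
  rewrite sumrB -mulr_suml mulrC; congr (_ - _).
  rewrite (bigD1 i) //= eqxx mul1r big1 ?addr0 ?expr2 // => j.
  by rewrite eq_sym => /negPf ->; rewrite mul0r.
under eq_bigr do rewrite exchange_big /=.
rewrite exchange_big /= mulr_sumr; apply: eq_bigr => pr _.
under eq_bigr do rewrite big_split /=.
by rewrite big_split /= !prodI; ring.
Qed.

Section Support.
Variable x : 'I_m -> R.
Hypothesis WC : forall i j, W i j = W j i.
Hypothesis W0 : forall i, W i i = 0.
Hypothesis W2 : forall i j, (W i j <= 2)%N.
Hypothesis x0 : forall i, 0 <= x i.

Definition heavy : rel 'I_m := fun a b => [&& 0 < x a, 0 < x b & W a b == 2].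

Lemma heavyC a b : heavy a b -> heavy b a.
Proof. by case/and3P => h1 h2 h3; rewrite /heavy h1 h2 WC h3. Qed.

Lemma W_le_heavy i j : 0 < x i -> 0 < x j -> (W i j <= (i != j) + heavy i j)%N.
Proof.
move=> xi xj; rewrite /heavy xi xj /=.
have [->|_] := eqVneq i j; first by rewrite W0.
by have := W2 i j; case: (W i j) => [|[|[|]]].
Qed.

Lemma bform_no_heavy : (forall a b, ~ heavy a b) ->
  bform W x x <= (\sum_i x i) ^+ 2.
Proof.
move=> nh; apply: le_trans (@bform_le_sets [::] x x0 _) _ => [i j xi xj|].
  apply: leq_trans (W_le_heavy xi xj) _; rewrite leq_add2l.
  by case: (boolP (heavy i j)) => // /nh.
by rewrite big_nil mulr0 addr0 gerBl sumr_ge0 // => i _; apply: sqr_ge0.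
Qed.

(** Reduces a double star to an inequality in a few reals: [A] and [B] are the total weights of the
    leaves at [b] and at [c], [alpha] and [beta] the sums of squares of these weights, and [Q] the
    sum of all squares. Without triangles the two sets of leaves are disjoint. *)
Lemma bform_cover b c (k l : nat) :
  (forall a b c, heavy a b -> heavy b c -> heavy c a -> False) ->
  heavy b c -> edge_cover heavy b c ->
  (#|[set j | heavy b j & j != c]%SET| <= k)%N ->
  (#|[set j | heavy c j & j != b]%SET| <= l)%N ->
  exists A B alpha beta Q : R,
    [/\ 0 <= A, 0 <= B, 0 <= alpha & 0 <= beta] /\
    [/\ A ^+ 2 <= k%:R * alpha, B ^+ 2 <= l%:R * beta,
      x b + x c + A + B <= \sum_i x i,
      x b ^+ 2 + x c ^+ 2 + alpha + beta <= Q &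
      bform W x x <=
        (\sum_i x i) ^+ 2 - Q + 2 * (x b * x c + x b * A + x c * B)].
Proof.
move=> noK3 bc cov; set Nb := finset _; set Nc := finset _ => Nbk Ncl.
exists (\sum_(i in Nb) x i), (\sum_(i in Nc) x i).
exists (\sum_(i in Nb) x i ^+ 2), (\sum_(i in Nc) x i ^+ 2).
exists (\sum_i x i ^+ 2).
have hI a : ~ heavy a a by case/and3P => _ _; rewrite W0.
have nbc : b != c by apply/eqP => E; rewrite E in bc; exact: hI bc.
have disj i : (\sum_(P <- [:: [set b]; [set c]; Nb; Nc]%SET) (i \in P) <= 1)%N.
  rewrite !big_cons big_nil !inE.
  have [ib|ib] := eqVneq i b.
    rewrite ib (negPf nbc) andbF; case: (boolP (heavy b b)) => // /hI //.
  have [ic|ic] := eqVneq i c.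
    rewrite ic andbF; case: (boolP (heavy c c)) => // /hI //.
  rewrite /= !andbT; case: (boolP (heavy b i)) => // bi; case: (boolP (heavy c i)) => // ci.
  by case: (noK3 _ _ _ bc ci (heavyC bi)).
split; split=> //; try by apply: sumr_ge0 => // i _; exact: sqr_ge0.
- exact: sum_sqr_le.
- exact: sum_sqr_le.
- have := sum_disjoint_le x0 disj.
  by rewrite !big_cons big_nil !big_set1 addr0 !addrA.
- have := sum_disjoint_le (fun i => sqr_ge0 (x i)) disj.
  by rewrite !big_cons big_nil !big_set1 addr0 !addrA.
apply: le_trans (@bform_le_sets [:: ([set b], [set c]); ([set b], Nb);
  ([set c], Nc)]%SET x x0 _) _; last first.
  by rewrite !big_cons big_nil /= !big_set1 addr0 addrA.
move=> i j xi xj; apply: leq_trans (W_le_heavy xi xj) _; rewrite leq_add2l.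
case: (boolP (heavy i j)) => // ij; rewrite !big_cons big_nil /= !inE.
have ji := heavyC ij; have nij : i != j by apply/eqP => E; rewrite E in ij; exact: hI ij.
rewrite !addn_gt0 !lt0b.
case: (cov _ _ ij) => E; subst; rewrite ?eqxx ?ij ?ji /=.
- by case: (j == c); rewrite /= ?orbT.
- by case: (j == b); rewrite /= ?orbT.
- by case: (i == c); rewrite /= ?orbT.
- by case: (i == b); rewrite /= ?orbT.
Qed.

Lemma bform_cycle5 a b c d f : cycle5 heavy a b c d f ->
  uniq [:: a; b; c; d; f] ->
  (forall u v, heavy u v -> u \in [:: a; b; c; d; f]) ->
  ~ heavy a c -> ~ heavy a d -> ~ heavy b d -> ~ heavy b f -> ~ heavy c f ->
  bform W x x <= (1 + 1 / 5) * (\sum_i x i) ^+ 2.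
Proof.
move=> C un cov ac ad bd bf cf.
have hI y : ~ heavy y y by case/and3P => _ _; rewrite W0.
have disj i : (\sum_(P <- [:: [set a]; [set b]; [set c]; [set d]; [set f]]%SET)
    (i \in P) <= 1)%N.
  have -> : (\sum_(P <- [:: [set a]; [set b]; [set c]; [set d]; [set f]]%SET)
    (i \in P) = count_mem i [:: a; b; c; d; f])%N.
    by rewrite !big_cons big_nil /= !finset.in_set1 ![i == _]eq_sym.
  by rewrite count_uniq_mem // leq_b1.
have S1 := sum_disjoint_le x0 disj.
have S2 := sum_disjoint_le (fun i => sqr_ge0 (x i)) disj.
rewrite !big_cons !big_nil !big_set1 !addr0 in S1 S2.
have h : bform W x x <= (\sum_i x i) ^+ 2 - \sum_i x i ^+ 2 +
    2 * (x a * x b + (x b * x c + (x c * x d + (x d * x f + x f * x a)))).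
  apply: le_trans (@bform_le_sets [:: ([set a], [set b]); ([set b], [set c]);
    ([set c], [set d]); ([set d], [set f]); ([set f], [set a])]%SET x x0 _) _; last first.
    by rewrite !big_cons big_nil /= !big_set1 addr0.
  move=> i j xi xj; apply: leq_trans (W_le_heavy xi xj) _; rewrite leq_add2l.
  case: (boolP (heavy i j)) => // ij; rewrite !big_cons big_nil /= !finset.in_set1.
  have ca h := ac (heavyC h); have da h := ad (heavyC h); have db h := bd (heavyC h).
  have fb h := bf (heavyC h); have fc h := cf (heavyC h).
  have := cov _ _ ij; have := cov _ _ (heavyC ij); rewrite !inE.
  move=> /or4P[/eqP jE|/eqP jE|/eqP jE|/orP[/eqP jE|/eqP jE]]
    /or4P[/eqP iE|/eqP iE|/eqP iE|/orP[/eqP iE|/eqP iE]]; move: ij; rewrite iE jE;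
    (try by first [move/hI | move/ac | move/ca | move/ad | move/da | move/bd
      | move/db | move/bf | move/fb | move/cf | move/fc]);
    by rewrite !addn_gt0 !lt0b ?eqxx /= ?orbT.
apply: le_trans h _.
set S := \sum_i x i in S1 *; set Q := \sum_i _ in S2 *.
have sS : (x a + (x b + (x c + (x d + x f)))) ^+ 2 <= S ^+ 2.
  by rewrite lerXn2r // nnegrE ?sumr_ge0 // !addr_ge0.
(* On C5, (sum y)^2 + 5 (sum y^2 - 2 sum y_i y_(i+1)) is the sum of the
   squares of y_i - 2 y_(i+1) + y_(i+2). *)
have := sqr_ge0 (x a - 2 * x b + x c); have := sqr_ge0 (x b - 2 * x c + x d).
have := sqr_ge0 (x c - 2 * x d + x f); have := sqr_ge0 (x d - 2 * x f + x a).
have := sqr_ge0 (x f - 2 * x a + x b).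
move: S1 S2 sS; rewrite !expr2; lra.
Qed.

End Support.
End Bound.

(** * Embedded patterns *)

Section Embeddings.
Variables (s q m : nat) (W : 'I_m -> 'I_m -> nat).
Hypothesis Wb : blowup_bounded s q W.
Implicit Types a b c d f : 'I_m.

Let mono u v k w : k <= w -> u * v * k <= u * v * w.
Proof. by move=> kw; rewrite leq_mul2l kw orbT. Qed.

Lemma fits_w3_of a b : 3 <= W a b -> fits_w3 s q.
Proof.
move=> ab u v uvs; have := @blowup_bounded5 s q m W a b a a a u v 0 0 0 Wb.
have := mono u v ab; lia.
Qed.

Lemma fits_k3_of a b c : 2 <= W a b -> 2 <= W b c -> 2 <= W c a -> fits_k3 s q.
Proof.
have [_ WC _] := Wb; rewrite (WC c a) => ab bc ac u v x us.
have := @blowup_bounded5 s q m W a b c a a u v x 0 0 Wb.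
have := mono u v ab; have := mono v x bc; have := mono u x ac; lia.
Qed.

Lemma fits_c4_of a b c d : 2 <= W a b -> 2 <= W b c -> 2 <= W c d -> 2 <= W d a ->
  0 < W a c -> 0 < W b d -> fits_c4 s q.
Proof.
have [_ WC _] := Wb; rewrite (WC d a) => ab bc cd ad ac bd u v x y us.
have := @blowup_bounded5 s q m W a b c d a u v x y 0 Wb.
have := mono u v ab; have := mono v x bc; have := mono x y cd.
have := mono u y ad; have := mono u x ac; have := mono v y bd; lia.
Qed.

Lemma fits_c5_of a b c d f :
  2 <= W a b -> 2 <= W b c -> 2 <= W c d -> 2 <= W d f -> 2 <= W f a ->
  0 < W a c -> 0 < W a d -> 0 < W b d -> 0 < W b f -> 0 < W c f -> fits_c5 s q.
Proof.
have [_ WC _] := Wb; rewrite (WC f a) => ab bc cd df af ac ad bd bf cf u v x y z us.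
have := @blowup_bounded5 s q m W a b c d f u v x y z Wb.
have := mono u v ab; have := mono v x bc; have := mono x y cd.
have := mono y z df; have := mono u z af.
have := mono u x ac; have := mono u y ad; have := mono v y bd.
have := mono v z bf; have := mono x z cf; lia.
Qed.

Lemma fits_star2_of a b c : 2 <= W a b -> 2 <= W a c -> 0 < W b c ->
  fits_star2 s q.
Proof.
move=> ab ac bc u v x us.
have := @blowup_bounded5 s q m W a b c a a u v x 0 0 Wb.
have := mono u v ab; have := mono v x bc; have := mono u x ac; lia.
Qed.

Lemma fits_path4_of a b c d : 2 <= W a b -> 2 <= W b c -> 2 <= W c d ->
  0 < W a c -> 0 < W a d -> 0 < W b d -> fits_path4 s q.
Proof.
move=> ab bc cd ac ad bd u v x y us.
have := @blowup_bounded5 s q m W a b c d a u v x y 0 Wb.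
have := mono u v ab; have := mono v x bc; have := mono x y cd.
have := mono u y ad; have := mono u x ac; have := mono v y bd; lia.
Qed.

Lemma fits_star3_of a b c d : 2 <= W a b -> 2 <= W a c -> 2 <= W a d ->
  0 < W b c -> 0 < W b d -> 0 < W c d -> fits_star3 s q.
Proof.
move=> ab ac ad bc bd cd u v x y us.
have := @blowup_bounded5 s q m W a b c d a u v x y 0 Wb.
have := mono u v ab; have := mono v x bc; have := mono x y cd.
have := mono u y ad; have := mono u x ac; have := mono v y bd; lia.
Qed.

Lemma fits_star4_of a b c d f :
  2 <= W a b -> 2 <= W a c -> 2 <= W a d -> 2 <= W a f ->
  0 < W b c -> 0 < W b d -> 0 < W b f -> 0 < W c d -> 0 < W c f -> 0 < W d f ->
  fits_star4 s q.
Proof.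
move=> ab ac ad af bc bd bf cd cf df u v x y z us.
have := @blowup_bounded5 s q m W a b c d f u v x y z Wb.
have := mono u v ab; have := mono v x bc; have := mono x y cd.
have := mono y z df; have := mono u z af.
have := mono u x ac; have := mono u y ad; have := mono v y bd.
have := mono v z bf; have := mono x z cf; lia.
Qed.

End Embeddings.

(** * Lagrangians of blow-up-bounded matrices *)

Section Lagrangian.
Local Open Scope ring_scope.
Variables (R : realType) (s q m : nat) (W : 'I_m -> 'I_m -> nat).
Hypothesis Wb : blowup_bounded s q W.
Hypothesis noS4 : ~ fits_star4 s q.

Let W0 : forall i, W i i = 0. Proof. by case: Wb. Qed.
Let WC : forall i j, W i j = W j i. Proof. by case: Wb. Qed.

Let W2 i j : (W i j <= 2)%N.
Proof.
rewrite leqNgt; apply/negP => /(fits_w3_of Wb) /(@fits_k3_w3 s q).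
by move/(@fits_star4_k3 s q).
Qed.

Section Reduced.
Variable x : 'I_m -> R.
Hypothesis x0 : forall i, 0 <= x i.
Hypothesis xr : reduced W x.
Let e := heavy W x.

Lemma reduced_pos a b c d : heavy W x a b -> heavy W x c d -> a <> c -> (0 < W a c)%N.
Proof.
by case/and3P=> xa _ _ /and3P[xc _ _] /eqP ac; apply: xr.1.
Qed.

Lemma heavy_ge2 a b : heavy W x a b -> (2 <= W a b)%N.
Proof. by case/and3P => _ _ /eqP ->. Qed.

Lemma heavy_noK3 a b c : e a b -> e b c -> e c a -> False.
Proof.
move=> /heavy_ge2 ab /heavy_ge2 bc /heavy_ge2 ca; apply: noS4.
exact: fits_star4_k3 (fits_k3_of Wb ab bc ca).
Qed.

Lemma heavy_noC4 a b c d : e a b -> e b c -> e c d -> e d a ->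
  a <> c -> b <> d -> False.
Proof.
move=> ab bc cd da ac bd; apply: noS4; apply: fits_star4_c4.
apply: (@fits_c4_of s q m W Wb a b c d); rewrite ?heavy_ge2 //.
- exact: (reduced_pos ab cd).
- exact: (reduced_pos bc da).
Qed.

(** If no cross pair is heavy, all four have multiplicity exactly 1: positive because [x] is
    reduced, and at most 2 by [W2]. This is the configuration that [reduced] forbids. *)
Lemma heavy_no2K2 a b c d : e a b -> e c d -> a <> c -> a <> d ->
  b <> c -> b <> d -> [\/ e a c, e a d, e b c | e b d].
Proof.
move=> ab cd ac ad bc bd; apply: contrapT => H.
have ba := heavyC WC ab; have dc := heavyC WC cd.
have W1 u v u' v' : e u u' -> e v v' -> u <> v -> ~ e u v -> W u v = 1%N.
  move=> uu vv uv nuv; have := reduced_pos uu vv uv; have := W2 u v.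
  move: uu vv nuv; rewrite /e /heavy => /and3P[-> _ _] /and3P[-> _ _] /=.
  by case: (W u v) => [|[|[|]]].
case/and3P: (ab) => xa xb /eqP Wab; case/and3P: (cd) => xc xd /eqP Wcd.
apply: (xr.2 a b c d) => //.
- by apply: (W1 _ _ _ _ ab cd ac) => h; apply: H; constructor 1.
- by apply: (W1 _ _ _ _ ab dc ad) => h; apply: H; constructor 2.
- by apply: (W1 _ _ _ _ ba cd bc) => h; apply: H; constructor 3.
- by apply: (W1 _ _ _ _ ba dc bd) => h; apply: H; constructor 4.
Qed.

Lemma bform_reduced_cycle5 a b c d f : cycle5 e a b c d f ->
  bform W x x <= (1 + 1 / 5) * (\sum_i x i) ^+ 2.
Proof.
move=> Cy; have [ab bc cd df fa] := Cy.
have eC := heavyC WC (x := x).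
have [nac nad] := cycle5_neq2 heavy_noK3 Cy.
have [nbd nbf] := cycle5_neq2 heavy_noK3 (cycle5_rot Cy).
have [ncf _] := cycle5_neq2 heavy_noK3 (cycle5_rot (cycle5_rot Cy)).
have ne u v : e u v -> u <> v by move=> /[swap] -> /and3P[_ _]; rewrite W0.
apply: (@bform_cycle5 R m W x WC W0 W2 x0 a b c d f) => //.
- have /eqP nab := ne _ _ ab; have /eqP nbc := ne _ _ bc; have /eqP ncd := ne _ _ cd.
  have /eqP ndf := ne _ _ df; have /eqP naf := nesym (ne _ _ fa).
  move/eqP: nac nad => nac /eqP nad; move/eqP: nbd nbf => nbd /eqP nbf.
  move/eqP: ncf => ncf.
  by rewrite /= !inE !negb_or nab nac nad naf nbc nbd nbf ncd ncf ndf.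
- by move=> u v; apply: (cycle5_covers eC heavy_noK3 heavy_noC4 heavy_no2K2 Cy).
- by move=> h; apply: (heavy_noK3 ab bc (eC _ _ h)).
- by move=> h; apply: (heavy_noK3 h df fa).
- by move=> h; apply: (heavy_noK3 bc cd (eC _ _ h)).
- by move=> h; apply: (heavy_noK3 h fa ab).
- by move=> h; apply: (heavy_noK3 cd df (eC _ _ h)).
Qed.

Lemma cycle5_fits a b c d f : cycle5 e a b c d f -> fits_c5 s q.
Proof.
move=> Cy; have [ab bc cd df fa] := Cy.
have [nac nad] := cycle5_neq2 heavy_noK3 Cy.
have [nbd nbf] := cycle5_neq2 heavy_noK3 (cycle5_rot Cy).
have [ncf _] := cycle5_neq2 heavy_noK3 (cycle5_rot (cycle5_rot Cy)).
apply: (@fits_c5_of s q m W Wb a b c d f); rewrite ?heavy_ge2 //.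
- exact: (reduced_pos ab cd).
- exact: (reduced_pos ab df).
- exact: (reduced_pos bc df).
- exact: (reduced_pos bc fa).
- exact: (reduced_pos cd fa).
Qed.

(** Three further neighbours would form with [c] the leaves of a [K_{1,4}] centred at [b]. *)
Lemma card_heavy_le2 b c : e b c -> (#|[set j | e b j & j != c]%SET| <= 2)%N.
Proof.
move=> bc; rewrite leqNgt; apply/negP => /card_gt2P[u [v [w [[]]]]].
rewrite !inE => /andP[bu /eqP uc] /andP[bv /eqP vc] /andP[bw /eqP wc].
move=> [/eqP uv /eqP vw /eqP wu].
have eC := heavyC WC (x := x); have cb := eC _ _ bc; have ub := eC _ _ bu.
have vb := eC _ _ bv; have wb := eC _ _ bw.
apply: noS4; apply: (@fits_star4_of s q m W Wb b c u v w); rewrite ?heavy_ge2 //.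
- exact: (reduced_pos cb ub (nesym uc)).
- exact: (reduced_pos cb vb (nesym vc)).
- exact: (reduced_pos cb wb (nesym wc)).
- exact: (reduced_pos ub vb uv).
- exact: (reduced_pos ub wb (nesym wu)).
- exact: (reduced_pos vb wb vw).
Qed.

Lemma card_heavy_le1 b c : ~ fits_star3 s q -> e b c ->
  (#|[set j | e b j & j != c]%SET| <= 1)%N.
Proof.
move=> noS3 bc; rewrite leqNgt; apply/negP => /card_gt1P[u [v []]].
rewrite !inE => /andP[bu /eqP uc] /andP[bv /eqP vc] /eqP uv.
have eC := heavyC WC (x := x); have cb := eC _ _ bc; have ub := eC _ _ bu.
have vb := eC _ _ bv.
apply: noS3; apply: (@fits_star3_of s q m W Wb b c u v); rewrite ?heavy_ge2 //.
- exact: (reduced_pos cb ub (nesym uc)).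
- exact: (reduced_pos cb vb (nesym vc)).
- exact: (reduced_pos ub vb uv).
Qed.

Lemma card_heavy_le0 b c : ~ fits_star2 s q -> e b c ->
  (#|[set j | e b j & j != c]%SET| <= 0)%N.
Proof.
move=> noS2 bc; rewrite leqNgt; apply/negP => /card_gt0P[u].
rewrite !inE => /andP[bu /eqP uc].
have eC := heavyC WC (x := x); have cb := eC _ _ bc; have ub := eC _ _ bu.
apply: noS2; apply: (@fits_star2_of s q m W Wb b c u); rewrite ?heavy_ge2 //.
exact: (reduced_pos cb ub (nesym uc)).
Qed.

(** Leaves [u] at [b] and [v] at [c] would give the path u b c v; they differ because there is no
    triangle. *)
Lemma card_heavy_path b c : ~ fits_path4 s q -> e b c ->
  (#|[set j | e b j & j != c]%SET| <= 0)%N \/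
  (#|[set j | e c j & j != b]%SET| <= 0)%N.
Proof.
move=> noP bc; have [|] := posnP #|[set j | e b j & j != c]%SET|; first by left; lia.
move=> /card_gt0P[u]; rewrite !inE => /andP[bu /eqP uc].
right; rewrite leqNgt; apply/negP => /card_gt0P[v].
rewrite !inE => /andP[cv /eqP vb].
have eC := heavyC WC (x := x); have ub := eC _ _ bu; have vc := eC _ _ cv.
apply: noP; apply: (@fits_path4_of s q m W Wb u b c v); rewrite ?heavy_ge2 //.
- exact: (reduced_pos ub cv uc).
- apply: (reduced_pos ub vc) => E; rewrite E in bu; exact: (heavy_noK3 bc cv (eC _ _ bu)).
- exact: (reduced_pos bc vc (nesym vb)).
Qed.

End Reduced.

(** The sum of entries is the form at the all-ones vector, and the classification of heavy graphs
    applies after reduction. Only the double star is left to the caller; the 5-cycle costs 1/5, but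
    it occurs only if C5 fits. *)
Lemma lagrangian_bound (mu : R) : 0 <= mu ->
  (fits_c5 s q -> 1 / 5 <= mu) ->
  (forall x, (forall i, 0 <= x i) -> reduced W x -> forall b c,
     heavy W x b c -> edge_cover (heavy W x) b c ->
     bform W x x <= (1 + mu) * (\sum_i x i) ^+ 2) ->
  (\sum_i \sum_j W i j)%:R <= (1 + mu) * m%:R ^+ 2.
Proof.
move=> mu0 c5 cov.
have -> : (\sum_i \sum_j W i j)%:R = bform W (fun=> 1) (fun=> 1) :> R.
  rewrite /bform natr_sum; apply: eq_bigr => i _; rewrite mulr1 natr_sum.
  by apply: eq_bigr => j _; rewrite mulr1.
have -> : m%:R = \sum_(i < m) 1 :> R by rewrite sumr_const card_ord.
apply: bform_reduced_le => // x x0 xr.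
have [noE|[b [c [bc bcov]]]|[a [b [c [d [f Cy]]]]]] :=
  cover_or_cycle5 (heavyC WC (x := x))
  (heavy_noK3 (x := x)) (heavy_noC4 xr) (heavy_no2K2 xr).
- apply: le_trans (bform_no_heavy W0 W2 x0 noE) _.
  by rewrite mulrDl mul1r lerDl mulr_ge0 // sqr_ge0.
- exact: (cov x x0 xr b c).
- apply: le_trans (bform_reduced_cycle5 x0 xr Cy) _.
  by rewrite ler_wpM2r ?sqr_ge0 // lerD2l c5 //; exact: (cycle5_fits xr Cy).
Qed.

Lemma lagrangian_star4 : (\sum_i \sum_j W i j)%:R <= (1 + 1 / 5) * m%:R ^+ 2 :> R.
Proof.
apply: lagrangian_bound => // x x0 xr b c bc cov.
have cb := heavyC WC bc.
have [A [B [al [be [Q [[A0 B0 al0 be0] [Aa Bb SE QE le]]]]]]] :=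
  bform_cover WC W0 W2 x0 (heavy_noK3 (x := x)) bc cov
    (card_heavy_le2 xr bc) (card_heavy_le2 xr cb).
apply: le_trans le _; set S := \sum_i x i in SE *.
have sS : (x b + x c + A + B) ^+ 2 <= S ^+ 2.
  by rewrite lerXn2r // nnegrE ?(le_trans _ SE) // !addr_ge0.
(* Both squares vanish at the extremal [K_{1,3}] with sizes 2:1:1:1, where (b, c, A, B) = (2, 1, 2,
   0). *)
have := sqr_ge0 (2 * (x b + x c) - 3 * (A + B)).
have := sqr_ge0 (2 * (x b - x c) - (A - B)).
move: Aa Bb QE sS; rewrite !expr2; lra.
Qed.

Lemma lagrangian_star3 : ~ fits_star3 s q ->
  (\sum_i \sum_j W i j)%:R <= (1 + 1 / 6) * m%:R ^+ 2 :> R.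
Proof.
move=> noS3; apply: lagrangian_bound => // [/(@fits_star3_c5 s q)//|x x0 xr b c bc cov].
have cb := heavyC WC bc.
have [A [B [al [be [Q [[A0 B0 al0 be0] [Aa Bb SE QE le]]]]]]] :=
  bform_cover WC W0 W2 x0 (heavy_noK3 (x := x)) bc cov
    (card_heavy_le1 xr noS3 bc) (card_heavy_le1 xr noS3 cb).
apply: le_trans le _; set S := \sum_i x i in SE *.
have sS : (x b + x c + A + B) ^+ 2 <= S ^+ 2.
  by rewrite lerXn2r // nnegrE ?(le_trans _ SE) // !addr_ge0.
(* The squares vanish at the extremal P4 with sizes 1:2:2:1, where (b, c, A, B) = (2, 2, 1, 1). *)
have := sqr_ge0 (x b + x c - 2 * (A + B)).
have := sqr_ge0 (2 * (x b - x c) - (A - B)); have := sqr_ge0 (A - B).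
move: Aa Bb QE sS; rewrite !expr2; lra.
Qed.

Lemma lagrangian_path4 : ~ fits_path4 s q ->
  (\sum_i \sum_j W i j)%:R <= (1 + 1 / 7) * m%:R ^+ 2 :> R.
Proof.
move=> noP; have noS3 : ~ fits_star3 s q by move/(@fits_path4_star3 s q).
apply: lagrangian_bound => // [/(@fits_star3_c5 s q)//|x x0 xr b c bc cov].
(* As P4 does not fit, one end of the edge [b c] has no other heavy neighbour; call it [c]. *)
wlog Nc : b c bc cov / (#|[set j | heavy W x c j & j != b]%SET| <= 0)%N.
  move=> H; have [Nb|Nc] := card_heavy_path xr noP bc; last exact: (H b c).
  apply: (H c b) => //; first exact: heavyC.
  by move=> u v /cov[]; [constructor 2|constructor 1|constructor 4|constructor 3].
have [A [B [al [be [Q [[A0 B0 al0 be0] [Aa Bb SE QE le]]]]]]] :=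
  bform_cover WC W0 W2 x0 (heavy_noK3 (x := x)) bc cov (card_heavy_le1 xr noS3 bc) Nc.
apply: le_trans le _; set S := \sum_i x i in SE *.
have B00 : B = 0.
  by move: Bb; rewrite mul0r => Bb; apply/eqP; rewrite -sqrf_eq0 eq_le Bb sqr_ge0.
have sS : (x b + x c + A + B) ^+ 2 <= S ^+ 2.
  by rewrite lerXn2r // nnegrE ?(le_trans _ SE) // !addr_ge0.
(* Equality holds at the extremal [K_{1,2}], where (b, c, A) = (3, 2, 2). *)
have := sqr_ge0 (4 * x b - 3 * (x c + A)); have := sqr_ge0 (x c - A).
move: Aa QE sS; rewrite B00 !expr2; lra.
Qed.

Lemma lagrangian_star2 : ~ fits_star2 s q ->
  (\sum_i \sum_j W i j)%:R <= (1 + 0) * m%:R ^+ 2 :> R.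
Proof.
move=> noS2; have noS3 : ~ fits_star3 s q.
  by move/(@fits_path4_star3 s q)/(@fits_star2_path4 s q).
apply: lagrangian_bound => // [/(@fits_star3_c5 s q)//|x x0 xr b c bc cov].
have cb := heavyC WC bc.
have [A [B [al [be [Q [[A0 B0 al0 be0] [Aa Bb SE QE le]]]]]]] :=
  bform_cover WC W0 W2 x0 (heavy_noK3 (x := x)) bc cov
    (card_heavy_le0 xr noS2 bc) (card_heavy_le0 xr noS2 cb).
apply: le_trans le _; set S := \sum_i x i in SE *.
have A00 : A = 0.
  by move: Aa; rewrite mul0r => Aa; apply/eqP; rewrite -sqrf_eq0 eq_le Aa sqr_ge0.
have B00 : B = 0.
  by move: Bb; rewrite mul0r => Bb; apply/eqP; rewrite -sqrf_eq0 eq_le Bb sqr_ge0.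
have := sqr_ge0 (x b - x c).
move: QE; rewrite A00 B00 !expr2; lra.
Qed.
End Lagrangian.

(** * The four ranges of [q] *)

Local Open Scope classical_set_scope.

Theorem theorem1p22 (R : realType) (s : nat) (hs : 2 <= s) :
  [/\ forall q : nat,
        'C(s, 2) <= q < Sigma (graph_pattern (star 2) 1) s ->
        exSigma_ratio R s q @ \oo --> (1 : R)%R,
      forall q : nat,
        Sigma (graph_pattern (star 2) 1) s <= q
          < Sigma (graph_pattern path4 1) s ->
        exSigma_ratio R s q @ \oo --> (1 + 1 / 7 : R)%R,
      forall q : nat,
        Sigma (graph_pattern path4 1) s <= q
          < Sigma (graph_pattern (star 3) 1) s ->
        exSigma_ratio R s q @ \oo --> (1 + 1 / 6 : R)%R
    & forall q : nat,
        Sigma (graph_pattern (star 3) 1) s <= q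
          < Sigma (graph_pattern (star 4) 1) s ->
        exSigma_ratio R s q @ \oo --> (1 + 1 / 5 : R)%R].
Proof.
(* By the comparison of patterns, the upper bound on [q] in each range also excludes [K_{1,4}], as
   all the Lagrangian bounds require. *)
have st43 q : ~ fits_star3 s q -> ~ fits_star4 s q.
  by move=> h /(@fits_star3_star4 s q).
have st3p q : ~ fits_path4 s q -> ~ fits_star4 s q.
  by move=> h; apply: st43 => /(@fits_path4_star3 s q).
have pst2 q : ~ fits_star2 s q -> ~ fits_star4 s q.
  by move=> h; apply: st3p => /(@fits_star2_path4 s q).
split=> q /andP[lo hi].
- have {}hi := not_fits_star2 hi.
  apply: (@exSigma_ratio_cvg R s q 1) => // [m W Wb|n sn _].
    by rewrite -[X in (X * _)%R]addr0; exact: (lagrangian_star2 R Wb (pst2 _ hi) hi).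
  exact: constant1_density.
- have {}hi := not_fits_path4 hi.
  apply: (@exSigma_ratio_cvg R s q 7) => // [m W Wb|n sn n7].
    exact: (lagrangian_path4 R Wb (st3p _ hi) hi).
  exact: star2_density.
- have {}hi := not_fits_star3 hi.
  apply: (@exSigma_ratio_cvg R s q 6) => // [m W Wb|n sn n7].
    exact: (lagrangian_star3 R Wb (st43 _ hi) hi).
  exact: path4_density.
- have {}hi := not_fits_star4 hi.
  apply: (@exSigma_ratio_cvg R s q 5) => // [m W Wb|n sn n7].
    exact: (lagrangian_star4 R Wb hi).
  exact: star3_density.
Qed.
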